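(* Let $\mathbb{S}^{3,3}=\{x\in\mathbb{R}^{3,4}: g(x,x)=-1\}$ with the induced pseudo-Riemannian metric of signature $(3,3)$, and let $\omega(X,Y)=g(PX,Y)$ be the fundamental 2-form of the almost para-complex Cayley structure $P$ on $\mathbb{S}^{3,3}$. Then $\omega$ is an eigenform of the Laplace operator: $\Delta\omega=-12\,\omega$.
   Context: The split Cayley algebra $\mathbf{Ca}'$ is the real vector space of elements $a+be$ with $a,b$ quaternions, with multiplication $(a+be)(c+de)=(ac+\overline d\,b)+(da+b\overline c)e$. With $e_1,e_2,e_3$ the standard quaternion units ($e_1e_2=e_3$), put $e_4=e$, $e_5=e_1e$, $e_6=e_2e$, $e_7=e_3e$. Conjugation is $\overline x=x_0-x_1e_1-\dots-x_7e_7$, and $\langle\cdot,\cdot\rangle$ is the scalar product with quadratic form $x\overline x=x_0^2+x_1^2+x_2^2+x_3^2-x_4^2-x_5^2-x_6^2-x_7^2$. The space $\mathbb{R}^{3,4}=\Im(\mathbf{Ca}')=\mathrm{span}(e_1,\dots,e_7)$ carries the restriction $g$ of $\langle\cdot,\cdot\rangle$, of signature $(3,4)$. The vector cross product is $X\times Y=\Im(XY)=XY+g(X,Y)$. With normal vector $\mathbf n(x)=x$, the almost para-complex Cayley structure is $P_x:T_x\mathbb{S}^{3,3}\to T_x\mathbb{S}^{3,3}$, $P_x(Y)=\mathbf n(x)\times Y$. The Laplacian on differential forms is $\Delta=d\delta+\delta d$, where on $k$-forms $\delta=(-1)^k\ast^{-1}d\,\ast=(-1)^{kn+n+1+\eta}\ast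 d\,\ast$, with $n=6$ the dimension, $\eta=3$ the number of minus signs of the metric, and $\ast$ the Hodge operator, $\alpha\wedge\ast\beta=g(\alpha,\beta)\mu_S$ for a metric volume form $\mu_S$ (so here $\delta=+\ast d\,\ast$). Exterior product and differential are taken without normalizing constants ($dx\wedge dy=dx\otimes dy-dy\otimes dx$). *)

(* Defs.v *)
From HB Require Import structures.
From mathcomp Require Import all_boot all_order all_algebra all_fingroup.
From mathcomp Require Import all_classical all_reals all_analysis.
From mathcomp Require Import ring.

Set Implicit Arguments.
Unset Strict Implicit.
Unset Printing Implicit Defensive.

Import Order.TTheory GRing.Theory Num.Theory.
Import numFieldNormedType.Exports.

Local Open Scope classical_set_scope.
Local Open Scope ring_scope.

Section SplitCayley.
Variable R : realType.

Record quat := Quat { q0 : R; q1 : R; q2 : R; q3 : R }.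

Definition qadd (a b : quat) : quat :=
  Quat (q0 a + q0 b) (q1 a + q1 b) (q2 a + q2 b) (q3 a + q3 b).

Definition qopp (a : quat) : quat := Quat (- q0 a) (- q1 a) (- q2 a) (- q3 a).

Definition qconj (a : quat) : quat := Quat (q0 a) (- q1 a) (- q2 a) (- q3 a).

Definition qmul (a b : quat) : quat :=
  Quat (q0 a * q0 b - q1 a * q1 b - q2 a * q2 b - q3 a * q3 b)
       (q0 a * q1 b + q1 a * q0 b + q2 a * q3 b - q3 a * q2 b)
       (q0 a * q2 b - q1 a * q3 b + q2 a * q0 b + q3 a * q1 b)
       (q0 a * q3 b + q1 a * q2 b - q2 a * q1 b + q3 a * q0 b).

Definition qdot (a b : quat) : R :=
  q0 a * q0 b + q1 a * q1 b + q2 a * q2 b + q3 a * q3 b.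

(* [Cayley a b] is a + b e; since (b e) has b as its quaternion coefficient,
   the coordinates along e_4, ..., e_7 = e, e_1 e, e_2 e, e_3 e are those of b. *)
Record cayley := Cayley { cl : quat; cr : quat }.

Definition cmul (x y : cayley) : cayley :=
  Cayley (qadd (qmul (cl x) (cl y)) (qmul (qconj (cr y)) (cr x)))
         (qadd (qmul (cr y) (cl x)) (qmul (cr x) (qconj (cl y)))).

Definition cconj (x : cayley) : cayley := Cayley (qconj (cl x)) (qopp (cr x)).

Definition cscal (x y : cayley) : R := qdot (cl x) (cl y) - qdot (cr x) (cr y).

Lemma cmul_conj (x : cayley) :
  cmul x (cconj x) = Cayley (Quat (cscal x x) 0 0 0) (Quat 0 0 0 0).
Proof.
case: x => [[a0 a1 a2 a3] [b0 b1 b2 b3]].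
rewrite /cmul /cconj /cscal /qdot /qadd /qmul /qconj /qopp /=.
by congr (Cayley (Quat _ _ _ _) (Quat _ _ _ _)); ring.
Qed.

(* R^{3,4} = Im(Ca'); the coordinate along e_(i+1) has index i. *)
Definition cayley_of (x : 'rV[R]_7) : cayley :=
  let c i := x 0 (inord i) in
  Cayley (Quat 0 (c 0) (c 1) (c 2)) (Quat (c 3) (c 4) (c 5) (c 6)).

Definition cayley_im (x : cayley) : 'rV[R]_7 :=
  \row_(i < 7) nth 0 [:: q1 (cl x); q2 (cl x); q3 (cl x);
                         q0 (cr x); q1 (cr x); q2 (cr x); q3 (cr x)] i.

Definition g (x y : 'rV[R]_7) : R := cscal (cayley_of x) (cayley_of y).

Definition cross (x y : 'rV[R]_7) : 'rV[R]_7 :=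
  cayley_im (cmul (cayley_of x) (cayley_of y)).

End SplitCayley.

Section Forms.
Variable R : realType.
Local Notation V := 'rV[R]_7.
Local Notation U := 'rV[R]_6.

Definition S33 : set V := [set x | g x x = -1].

Definition tangent (x v : V) : Prop := g x v = 0.

Fixpoint Cn (W : normedModType R) (n : nat) (D : set U) (f : U -> W) : Prop :=
  match n with
  | 0 => forall u, D u -> {for u, continuous f}
  | n'.+1 => (forall u, D u -> differentiable f u) /\
             (forall w, Cn n' D (fun u => 'D_w f u))
  end.

Definition smooth (W : normedModType R) (D : set U) (f : U -> W) : Prop :=
  forall n, Cn n D f.

(* Injective immersions of open subsets of R^6 into the 6-dimensional S33: by
   the inverse function theorem these are exactly the inverses of its charts. *)
Definition parametrization (D : set U) (phi : U -> V) : Prop :=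
  [/\ open D, smooth D phi, (forall u, D u -> S33 (phi u)),
      (forall u u', D u -> D u' -> phi u = phi u' -> u = u') &
      (forall u, D u -> injective ('d phi u))].

(* A k-form on S33 is represented by a function of all points and vectors of
   R^{3,4}; only its values at points of S33 on tangent vectors matter. *)
Definition kform (k : nat) := V -> ('I_k -> V) -> R.

Definition eq_form k (a b : kform k) : Prop :=
  forall x, S33 x -> forall v, (forall i, tangent x (v i)) -> a x v = b x v.

Definition upd k (v : 'I_k -> V) (i : 'I_k) (y : V) : 'I_k -> V :=
  fun j => if j == i then y else v j.

Definition alternating_at (x : V) k (a : ('I_k -> V) -> R) : Prop :=
  (forall v i (c : R) y z,
     (forall j, tangent x (v j)) -> tangent x y -> tangent x z ->
     a (upd v i (c *: y + z)) = c * a (upd v i y) + a (upd v i z)) /\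
  (forall v i j,
     (forall l, tangent x (v l)) -> i != j -> v i = v j -> a v = 0).

Definition pullback (phi : U -> V) k (a : kform k) : U -> ('I_k -> U) -> R :=
  fun u w => a (phi u) (fun i => 'd phi u (w i)).

Definition diff_form k (a : kform k) : Prop :=
  (forall x, S33 x -> alternating_at x (a x)) /\
  (forall D phi, parametrization D phi ->
     forall w : 'I_k -> U, smooth D (fun u => pullback phi a u w)).

(* Evaluation on constant vector fields of
   d (\sum_I t_I du^I) = \sum_(i, I) (\partial_i t_I) du^i /\ du^I. *)
Definition flat_d k (t : U -> ('I_k -> U) -> R) : U -> ('I_k.+1 -> U) -> R :=
  fun u w => \sum_(i < k.+1)
    (-1) ^+ i * 'D_(w i) (fun u' => t u' (fun j => w (lift i j))) u.

(* b = d a. *)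
Definition is_d k (a : kform k) (b : kform k.+1) : Prop :=
  [/\ diff_form a, diff_form b &
      forall D phi, parametrization D phi -> forall u, D u ->
        forall w, pullback phi b u w = flat_d (pullback phi a) u w].

(* Normalized so that dx /\ dy = dx (x) dy - dy (x) dx. *)
Definition extprod k l (a : ('I_k -> V) -> R) (b : ('I_l -> V) -> R)
    (v : 'I_(k + l) -> V) : R :=
  (k`!%:R * l`!%:R)^-1 * \sum_(s : 'S_(k + l)) (-1) ^+ s *
    a (fun i => v (s (lshift l i))) * b (fun j => v (s (rshift k j))).

Definition orthonormal_frame (x : V) (E : 'I_6 -> V) : Prop :=
  [/\ forall i, tangent x (E i),
      forall i, g (E i) (E i) = 1 \/ g (E i) (E i) = -1 &
      forall i j, i != j -> g (E i) (E j) = 0].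

(* The sum over all multi-indices counts each increasing one k! times, so that
   the E^{i_1} /\ ... /\ E^{i_k} with i_1 < ... < i_k have scalar squares +-1. *)
Definition form_scal k (E : 'I_6 -> V) (a b : ('I_k -> V) -> R) : R :=
  (k`!%:R)^-1 * \sum_(I : {ffun 'I_k -> 'I_6})
    (\prod_(i < k) g (E (I i)) (E (I i))) *
    a (fun i => E (I i)) * b (fun i => E (I i)).

Definition metric_volume_form (mu : kform 6) : Prop :=
  diff_form mu /\
  forall x, S33 x -> forall E, orthonormal_frame x E -> `|mu x E| = 1.

(* c = * b, i.e. a /\ c = g(a, b) mu for every k-covector a at every point. *)
Definition is_hodge (mu : kform 6) k l (kl : (k + l)%N = 6)
    (b : kform k) (c : kform l) : Prop :=
  [/\ diff_form b, diff_form c &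
      forall x, S33 x -> forall E, orthonormal_frame x E ->
      forall a : ('I_k -> V) -> R, alternating_at x a ->
      forall v : 'I_6 -> V, (forall i, tangent x (v i)) ->
        extprod a (c x) (fun i => v (cast_ord kl i)) =
        form_scal E a (b x) * mu x v].

(* c = \delta b = (-1)^(pn + n + 1 + eta) * d * b for b of degree p = k + 1,
   where n = 6 and eta = 3. *)
Definition is_codiff (mu : kform 6) k (b : kform k.+1) (c : kform k) : Prop :=
  exists (l : nat) (h : (k.+1 + l)%N = 6) (h' : (l.+1 + k)%N = 6)
         (sb : kform l) (dsb : kform l.+1) (sdsb : kform k),
  [/\ is_hodge mu h b sb, is_d sb dsb, is_hodge mu h' dsb sdsb &
      eq_form c (fun x v => (-1) ^+ (k.+1 * 6 + 6 + 1 + 3) * sdsb x v)].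

(* c = \Delta b = d \delta b + \delta d b, in positive degree. *)
Definition is_laplacian (mu : kform 6) k (b c : kform k.+1) : Prop :=
  exists (delb : kform k) (ddelb : kform k.+1) (db : kform k.+2) (deldb : kform k.+1),
  [/\ is_codiff mu b delb, is_d delb ddelb, is_d b db, is_codiff mu db deldb &
      eq_form c (fun x v => ddelb x v + deldb x v)].

(* P_x = n(x) \times -, with normal vector n(x) = x. *)
Definition paraP (x y : V) : V := cross x y.

Definition omega : kform 2 := fun x v => g (paraP x (v ord0)) (v ord_max).

End Forms.

(* Main.v *)
Require Import Defs.
From mathcomp Require Import all_boot all_order all_algebra all_fingroup.
From mathcomp Require Import all_classical all_reals all_analysis.
From mathcomp Require Import ring.

(** The fundamental form is omega_x = alpha(x, ., .), where alpha(x, y, z) =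
    g(cross x y, z) is an alternating trilinear form on R^{3,4}
    ([alternating_cross_form]).  For every constant 3-form alpha of R^{3,4}, such a
    radial contraction is an eigenform of the Laplacian of S^{3,3} for the
    eigenvalue -12 ([radial3_laplacian]).

    The forms that occur are of two kinds: restrictions to the sphere of constant
    forms A of R^{3,4}, and radial contractions A(x, ., ...).  Differentiating
    their pullbacks along a parametrization produces second derivatives of the
    parametrization; these cancel, being symmetric (Schwarz's theorem, [deriveC])
    and plugged into an alternating form ([alternating_hessian_sum]).  What remains
    is d A = 0 ([is_d_const]) and, for A of degree k, d (A(x, ...)) = k A
    ([is_d_radial]).

    Let psi be the Hodge dual of alpha in the flat space R^{3,4} ([star3]).  It is
    a contraction with the inverse metric, and therefore it may be computed in any
    orthonormal frame ([star3_frame]): if F is one, then psi(F_3, ..., F_6) =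
    g_0 g_1 g_2 alpha(F_0, F_1, F_2) det F, with g_i = g(F_i, F_i)
    ([star3_orthonormal]).  Completing an orthonormal frame of the tangent space by
    x itself, in various orders, this one identity gives all the Hodge duals on the
    sphere.  With the volume form mu_x = e(x) det(x, ...), e = 1 or -1, they are
      star omega = - e psi,   star alpha = - e psi(x, ...),
      star (e psi) = omega;
    the last one uses that the scalar squares g_i of a tangent frame have product
    -1, because det(x, E)^2 = 1.  Hence delta omega = 0, as psi is closed, and
    d omega = 3 alpha, d (star d omega) = d (- 3 e psi(x, ...)) = - 12 e psi, so that
    delta d omega = - 12 omega.

    The Hodge operator is pinned down by its values on orthonormal frames
    ([is_hodge_frames]), because both sides of its definition are alternating
    6-forms on a 6-dimensional space.  The same argument shows that an arbitrary
    metric volume form is the standard one up to a sign e, which may be chosen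
    point by point but is locally constant along parametrizations
    ([metric_volume_form_sign]), hence commutes with d. *)

Set Implicit Arguments.
Unset Strict Implicit.
Unset Printing Implicit Defensive.

Import Order.TTheory GRing.Theory Num.Theory.
Import numFieldNormedType.Exports.

Local Open Scope classical_set_scope.
Local Open Scope ring_scope.

(** * Maps of class C^n on an open set *)

Section Calculus.
Variable R : realType.
Local Notation U := 'rV[R]_6.

(** h - f vanishes near u, so it is differentiable there with zero differential. *)
Lemma near_eq_differentiable (W : normedModType R) (f h : U -> W) (u : U) :
  (\near u, f u = h u) -> differentiable f u -> differentiable h u.
Proof.
move=> fh df.
pose e : U -> W := h - f.
have e0 : \forall x \near (0 : U), e (x + u) = 0.
  have := fh; rewrite (near_shift 0 u (fun x => f x = h x)) => fh0.
  have {}fh0 : \forall x \near (0 : U), f (x + u) = h (x + u).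
    by apply: filterS fh0 => x; rewrite /= subr0.
  near=> x; rewrite /e.
  have fhx : f (x + u) = h (x + u) by near: x.
  rewrite -[LHS]/(h (x + u) - f (x + u)).
  by rewrite fhx subrr.
have eu : e u = 0 by move/nbhs_singleton : e0; rewrite add0r.
have oe : e \o shift u = cst (e u) + (\0 : U -> W) +o_ (0 : U) id.
  apply/eqaddoP => _/posnumP[eps]; near=> x.
  have ex : e (x + u) = 0 by near: x.
  rewrite /= -[_ x]/(e (x + u) - (e u + 0)) ex eu addr0 subrr normr0 mulr_ge0//.
have c0 : continuous (\0 : U -> W) by move=> x; exact: cst_continuous.
have de : 'd e u = (\0 : U -> W) :> (U -> W) by exact: diff_unique oe.
have diffe : differentiable e u.
  by apply/diff_locallyP; rewrite de.
have -> : h = e + f by apply/funext => x; rewrite /e -[RHS]/(h x - f x + f x) subrK.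
exact: differentiableD.
Unshelve. all: by end_near. Qed.

Lemma near_open (D : set U) (P : U -> Prop) u : open D -> D u ->
  (forall x, D x -> P x) -> \near u, P u.
Proof. by move=> oD Du DP; have := open_nbhs_nbhs (conj oD Du); apply: filterS. Qed.

Lemma eq_Cn (W : normedModType R) n (D : set U) (f h : U -> W) : open D ->
  (forall u, D u -> f u = h u) -> Cn n D f -> Cn n D h.
Proof.
move=> oD; elim: n f h => [|n IH] f h fh /=.
  move=> cf u Du; rewrite /prop_for /continuous_at -(fh u Du).
  have nfh : {near nbhs u, f =1 h} by exact: near_open oD Du fh.
  exact: cvg_trans (near_eq_cvg nfh) (cf u Du).
move=> [df Hf]; split=> [u Du|w].
  by apply: near_eq_differentiable (df u Du); exact: near_open oD Du fh.
apply: IH (Hf w) => u Du; apply: near_eq_derive.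
exact: near_open oD Du fh.
Qed.

Lemma CnW (W : normedModType R) n (D : set U) (f : U -> W) : Cn n.+1 D f -> Cn n D f.
Proof.
elim: n f => [|n IH] f [df Hf].
  by move=> u Du; apply/differentiable_continuous/df.
by split=> // w; apply: IH; apply: Hf.
Qed.

Lemma CnD (W : normedModType R) n (D : set U) (f h : U -> W) : open D ->
  Cn n D f -> Cn n D h -> Cn n D (fun u => f u + h u).
Proof.
move=> oD; elim: n f h => [|n IH] f h.
  by move=> cf ch u Du; exact: (cvgD (cf u Du) (ch u Du)).
move=> [df Hf] [dh Hh]; split=> [u Du|w].
  exact: (differentiableD (df u Du) (dh u Du)).
apply: eq_Cn (IH _ _ (Hf w) (Hh w)) => // u Du.
by rewrite -deriveD //; apply: diff_derivable; [exact: df|exact: dh].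
Qed.

Lemma CnM n (D : set U) (f h : U -> R) : open D ->
  Cn n D f -> Cn n D h -> Cn n D (fun u => f u * h u).
Proof.
move=> oD; elim: n f h => [|n IH] f h.
  by move=> cf ch u Du; exact: (cvgM (cf u Du) (ch u Du)).
move=> Cf Ch; have [df Hf] := Cf; have [dh Hh] := Ch; split=> [u Du|w].
  exact: (differentiableM (df u Du) (dh u Du)).
apply: (@eq_Cn _ _ _ (fun u => f u * 'D_w h u + h u * 'D_w f u)) => //.
  move=> u Du.
  by rewrite -[RHS]/('D_w (f * h) u) deriveM //; apply: diff_derivable; [exact: df|exact: dh].
apply: CnD => //; apply: IH; [exact: CnW|exact: Hh|exact: CnW|exact: Hf].
Qed.

Lemma Cn_cst (W : normedModType R) n (D : set U) (a : W) : Cn n D (fun _ => a).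
Proof.
elim: n a => [|n IH] a; first by move=> u Du; exact: cst_continuous.
split=> [u Du|w]; first exact: differentiable_cst.
have -> : (fun u => 'D_w (fun _ : U => a) u) = fun=> 0.
  by apply/funext => u; exact: derive_cst.
exact: IH.
Qed.

Lemma smooth_sum (I : Type) (r : seq I) (D : set U) (f : I -> U -> R) : open D ->
  (forall i, smooth D (f i)) -> smooth D (fun u => \sum_(i <- r) f i u).
Proof.
move=> oD sf n; elim: r => [|i r IH].
  have -> : (fun u => \sum_(i <- [::]) f i u) = fun=> 0.
    by apply/funext => u; rewrite big_nil.
  exact: Cn_cst.
have -> : (fun u => \sum_(j <- i :: r) f j u) = fun u => f i u + \sum_(j <- r) f j u.
  by apply/funext => u; rewrite big_cons.
by apply: CnD => //; exact: sf.
Qed.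

Lemma smooth_derive (W : normedModType R) (D : set U) (f : U -> W) w :
  smooth D f -> smooth D (fun u => 'D_w f u).
Proof. by move=> sf n; have [_] := sf n.+1; apply. Qed.

Lemma smooth_differentiable (W : normedModType R) (D : set U) (f : U -> W) u :
  smooth D f -> D u -> differentiable f u.
Proof. by move=> sf Du; have [+ _] := sf 1%N; apply. Qed.

Lemma derive_coord m (f : U -> 'rV[R]_m) j u w : derivable f u w ->
  'D_w (fun u => f u 0 j) u = ('D_w f u) 0 j.
Proof. by move=> df; rewrite (derive_mx df) mxE. Qed.

Lemma smooth_coord m (D : set U) (f : U -> 'rV[R]_m.+1) j : open D ->
  smooth D f -> smooth D (fun u => f u 0 j).
Proof.
move=> oD sf n; have := sf n; elim: n f {sf} => [|n IH] f.
  move=> cf u Du; apply: (@continuous_comp _ _ _ f (fun N : 'rV[R]_m.+1 => N 0 j) u (cf u Du)).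
  exact: coord_continuous.
move=> [df Hf]; split=> [u Du|w].
  apply: (@differentiable_comp _ _ _ _ f (fun N => N 0 j)); first exact: df.
  exact: differentiable_coord.
apply: eq_Cn (IH _ (Hf w)) => // u Du.
by rewrite derive_coord //; apply/diff_derivable/df.
Qed.

End Calculus.

(** * Symmetry of second derivatives *)

Section Schwarz.
Variable R : realType.
Local Notation U := 'rV[R]_6.
Implicit Types (f : U -> R) (p u v w : U) (s t : R) (D : set U).

(** Along a line, the ordinary derivative and the directional derivative have the
    same difference quotients. *)
Lemma is_derive_line f p v s : differentiable f (p + s *: v) ->
  is_derive s (1 : R) (fun r => f (p + r *: v)) ('D_v f (p + s *: v)).
Proof.
move=> /(@diff_derivable _ _ _ _ _ v) df.
have E : (fun h : R => h^-1 *: ((f (p + (h *: (1 : R) + s) *: v)) - f (p + s *: v))) =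
         (fun h : R => h^-1 *: (f (h *: v + (p + s *: v)) - f (p + s *: v))).
  apply/funext => h; congr (_ *: (f _ - _)).
  by rewrite -[h *: (1 : R)]/(h * 1) mulr1 scalerDl addrCA.
apply: DeriveDef.
  by rewrite /derivable /= E.
by rewrite /derive /= E.
Qed.

Lemma MVT_line f p v t : 0 < t ->
  (forall s, 0 <= s <= t -> differentiable f (p + s *: v)) ->
  exists2 c, 0 <= c <= t & f (p + t *: v) - f p = t * 'D_v f (p + c *: v).
Proof.
move=> t0 df.
have [||c cI E] := @MVT R (fun s => f (p + s *: v)) (fun s => 'D_v f (p + s *: v)) 0 t t0.
- move=> s; rewrite in_itv /= => /andP[s0 st]; apply: is_derive_line.
  by apply: df; rewrite !ltW.
- apply: continuous_in_subspaceT => s; rewrite inE /= in_itv /= => sI.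
  apply: differentiable_continuous; apply/derivable1_diffP.
  by have := is_derive_line (df _ sI); case.
exists c; first by move: cI; rewrite in_itv /= => /andP[c0 ct]; rewrite !ltW.
by rewrite mulrC; move: E; rewrite scale0r addr0 subr0.
Qed.

(** Divided by t^2, this approximates both mixed second derivatives of f at u; it
    is symmetric in v and w, which is the whole point. *)
Definition second_difference f u v w t : R :=
  f (u + t *: v + t *: w) - f (u + t *: v) - (f (u + t *: w) - f u).

(** The mean value theorem is used twice: along v for x |-> f (x + t w) - f x, then
    along w for 'D_v f. *)
Lemma second_difference_MVT D f u v w t : 0 < t -> Cn 2 D f ->
  (forall a b, 0 <= a <= t -> 0 <= b <= t -> D (u + a *: v + b *: w)) ->
  exists a b, [/\ 0 <= a <= t, 0 <= b <= t &
    second_difference f u v w t =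
    t * (t * 'D_w (fun x => 'D_v f x) (u + a *: v + b *: w))].
Proof.
move=> t0 [df Hf] HD.
have tt : 0 <= t <= t by rewrite lexx ltW.
have t00 : 0 <= (0:R) <= t by apply/andP; split; [exact: lexx|exact: ltW].
have HD0 a : 0 <= a <= t -> D (u + a *: v).
  by move=> ha; have := HD _ 0 ha t00; rewrite scale0r addr0.
pose F x := f (x + t *: w) - f x.
have dsh s : 0 <= s <= t -> differentiable (fun x => f (x + t *: w)) (u + s *: v).
  move=> st; apply: differentiable_comp => //.
  by apply/df/HD.
have dF s : 0 <= s <= t -> differentiable F (u + s *: v).
  by move=> st; apply: differentiableB; [exact: dsh|exact/df/HD0].
have [a aI E] := MVT_line t0 dF.
have [b bI E'] : exists2 b, 0 <= b <= t &
   'D_v f (u + a *: v + t *: w) - 'D_v f (u + a *: v) =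
   t * 'D_w (fun x => 'D_v f x) (u + a *: v + b *: w).
  apply: (@MVT_line (fun x => 'D_v f x)) => // s st.
  by have [dv _] := Hf v; apply/dv/HD.
exists a, b; split => //.
rewrite -E' /second_difference.
rewrite -[LHS]/(F (u + t *: v) - F u) E; congr (_ * _).
rewrite /F.
rewrite -[LHS]/('D_v ((fun x => f (x + t *: w)) - f) (u + a *: v)) deriveB; last 2 first.
- exact/diff_derivable/dsh.
- exact/diff_derivable/df/HD0.
congr (_ - _); rewrite /derive.
set G := (X in lim (X @ _) = _); set H := (X in _ = lim (X @ _)).
by have -> : G = H by apply/funext => h; rewrite /G /H /= -!addrA.
Qed.

Lemma nbhs_box u v w (P : set U) : nbhs u P -> exists2 t, 0 < t &
  forall a b, 0 <= a <= t -> 0 <= b <= t -> P (u + a *: v + b *: w).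
Proof.
move=> /nbhs_normP[e /= e0 He].
have n0 : 0 < `|v| + `|w| + 1 by rewrite ltr_wpDl.
exists (e / (`|v| + `|w| + 1)); first exact: divr_gt0.
move=> a b /andP[a0 at_] /andP[b0 bt]; apply: He => /=.
rewrite -addrA opprD addNKr normrN.
apply: le_lt_trans (ler_normD _ _) _; rewrite !normrZ !ger0_norm //.
apply: (@le_lt_trans _ _ (e / (`|v| + `|w| + 1) * (`|v| + `|w|))).
  by rewrite mulrDr lerD // ler_wpM2r.
by rewrite mulrAC ltr_pdivrMr // ltr_pM2l // ltrDl.
Qed.

(** Schwarz's theorem: the same second difference is t^2 times each of the two mixed
    derivatives, at points that tend to u with t. *)
Lemma deriveC D f u v w : open D -> Cn 2 D f -> D u ->
  'D_v (fun x => 'D_w f x) u = 'D_w (fun x => 'D_v f x) u.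
Proof.
move=> oD Cf Du; have [df Hf] := Cf.
have [_ Hv] := Hf v; have [_ Hw] := Hf w.
have cvw := Hv w u Du; have cwv := Hw v u Du.
apply/eqP; rewrite -subr_eq0 -normr_le0; apply/ler_addgt0Pl => e e0; rewrite addr0.
have e2 : 0 < e / 2 by rewrite divr_gt0.
(* Near u, both mixed derivatives are within e/2 of their values at u. *)
pose P x := [/\ D x, `|'D_w (fun x => 'D_v f x) u - 'D_w (fun x => 'D_v f x) x| < e / 2 &
   `|'D_v (fun x => 'D_w f x) u - 'D_v (fun x => 'D_w f x) x| < e / 2].
have nP : nbhs u P.
  have /cvgrPdist_lt/(_ _ e2) n1 := cvw.
  have /cvgrPdist_lt/(_ _ e2) n2 := cwv.
  have n3 : nbhs u D by exact: open_nbhs_nbhs.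
  by apply: filterS3 n3 n1 n2 => x h3 h1 h2; exact: And3 h3 h1 h2.
have [t t0 tP] := nbhs_box v w nP.
have [|a [b [aI bI E]]] := @second_difference_MVT D f u v w t t0 Cf.
  by move=> a b ha hb; have [] := tP a b ha hb.
have tP' c d : 0 <= c <= t -> 0 <= d <= t -> P (u + c *: w + d *: v).
  by move=> hc hd; rewrite addrAC; exact: tP.
have [|c [d [cI dI E']]] := @second_difference_MVT D f u w v t t0 Cf.
  by move=> c d hc hd; have [] := tP' c d hc hd.
have EE : second_difference f u v w t = second_difference f u w v t.
  rewrite /second_difference (addrAC u) !opprB addrACA [RHS]addrACA.
  by congr (_ + _); rewrite addrC.
move: EE; rewrite E E' => /(mulfI (lt0r_neq0 t0)) /(mulfI (lt0r_neq0 t0)) EE.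
have [_ + _] := tP _ _ aI bI; rewrite EE => h1.
have [_ _ h2] := tP' _ _ cI dI.
set q := (X in `|_ - X|) in h2; rewrite -/q in h1.
apply: le_trans (ler_distD q _ _) _; rewrite [X in _ <= X](splitr e).
by apply: lerD; [exact: (ltW h2)|rewrite distrC; exact: (ltW h1)].
Qed.
End Schwarz.

(** * Alternating forms *)

Section Alternating.
Variable R : realType.
Local Notation V := 'rV[R]_7.

Definition multilinear_on (T : V -> Prop) k (a : ('I_k -> V) -> R) : Prop :=
  forall v i (c : R) y z, (forall j, T (v j)) -> T y -> T z ->
    a (upd v i (c *: y + z)) = c * a (upd v i y) + a (upd v i z).

(** The volume form and the test covectors of the Hodge operator are alternating
    on tangent vectors only, hence the relativization to T; for T = tangent x this
    is [alternating_at x]. *)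
Definition alternating_on (T : V -> Prop) k (a : ('I_k -> V) -> R) : Prop :=
  multilinear_on T a /\
  (forall v i j,
     (forall l, T (v l)) -> i != j -> v i = v j -> a v = 0).

Definition multilinear_form k (A : ('I_k -> V) -> R) : Prop :=
  forall v i (c : R) y z,
    A (upd v i (c *: y + z)) = c * A (upd v i y) + A (upd v i z).

Definition alternating_form k (A : ('I_k -> V) -> R) : Prop :=
  multilinear_form A /\ forall v i j, i != j -> v i = v j -> A v = 0.

Lemma alternating_onW (T : V -> Prop) k (A : ('I_k -> V) -> R) :
  alternating_form A -> alternating_on T A.
Proof. by case=> ml alt; split=> [v i c y z _ _ _|v i j _]; [exact: ml|exact: alt]. Qed.

Lemma alternating_onT k (A : ('I_k -> V) -> R) :
  alternating_form A -> alternating_on (fun _ => True) A.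
Proof. exact: alternating_onW. Qed.

Definition linear_pred (T : V -> Prop) : Prop :=
  T 0 /\ forall (c : R) y z, T y -> T z -> T (c *: y + z).

Lemma linear_pred_sum (T : V -> Prop) n (m : 'I_n -> R) (y : 'I_n -> V) :
  linear_pred T -> (forall b, T (y b)) -> T (\sum_b m b *: y b).
Proof.
move=> [T0 Tl] Ty; elim/big_ind: _ => //.
  by move=> p q Tp Tq; rewrite -[p]scale1r; exact: Tl.
by move=> b _; rewrite -[_ *: _]addr0; exact: Tl.
Qed.

Lemma upd_same k (v : 'I_k -> V) i y : upd v i y i = y.
Proof. by rewrite /upd eqxx. Qed.

Lemma upd_id k (v : 'I_k -> V) i : upd v i (v i) = v.
Proof. by apply/funext => j; rewrite /upd; case: eqP => [->|]. Qed.

Lemma updC k (v : 'I_k -> V) i j y z : i != j ->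
  upd (upd v i y) j z = upd (upd v j z) i y.
Proof.
move=> ij; apply/funext => l; rewrite /upd.
by have [->|//] := eqVneq l j; rewrite eq_sym (negPf ij).
Qed.

Lemma upd_pred (T : V -> Prop) k (v : 'I_k -> V) i y :
  (forall j, T (v j)) -> T y -> forall j, T (upd v i y j).
Proof. by move=> Tv Ty j; rewrite /upd; case: eqP. Qed.

Lemma multilinear_on_sum (T : V -> Prop) k (a : ('I_k -> V) -> R) v i n
    (m : 'I_n -> R) (y : 'I_n -> V) :
  linear_pred T -> multilinear_on T a ->
  (forall j, T (v j)) -> (forall b, T (y b)) ->
  a (upd v i (\sum_b m b *: y b)) = \sum_b m b * a (upd v i (y b)).
Proof.
move=> Tlin ml Tv Ty; have [T0 Tl] := Tlin.
have a0 : a (upd v i 0) = 0.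
  have := ml v i (-1) 0 0 Tv T0 T0.
  by rewrite scaler0 addr0 mulN1r addNr.
elim: n m y Ty => [|n IH] m y Ty; first by rewrite !big_ord0.
rewrite !big_ord_recl /= ml //; first by rewrite IH.
exact: linear_pred_sum.
Qed.

Lemma linear_predT : linear_pred (fun _ : V => True).
Proof. by []. Qed.

Lemma multilinear_sum k (A : ('I_k -> V) -> R) v i n (m : 'I_n -> R) (y : 'I_n -> V) :
  multilinear_form A -> A (upd v i (\sum_b m b *: y b)) = \sum_b m b * A (upd v i (y b)).
Proof.
move=> ml; apply: (multilinear_on_sum _ _ linear_predT) => //.
Qed.

Section OnT.
Variables (T : V -> Prop) (k : nat) (a : ('I_k -> V) -> R).
Hypothesis (Tlin : linear_pred T) (alt : alternating_on T a).

(** Polarization of the vanishing on repeated arguments. *)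
Lemma alternating_on_swap v i j : (forall l, T (v l)) -> i != j ->
  a (v \o tperm i j) = - a v.
Proof.
move=> Tv ij; have [T0 Tl] := Tlin; have [ml al] := alt.
pose f y z := a (upd (upd v i y) j z).
have fyy y : T y -> f y y = 0.
  move=> Ty; have Tu := upd_pred j (upd_pred i Tv Ty) Ty.
  by apply: (al _ i j) => //; rewrite upd_same updC // upd_same.
have fr x y z : T x -> T y -> T z -> f x (y + z) = f x y + f x z.
  move=> Tx Ty Tz; rewrite -[y in LHS]scale1r -[f x y]mul1r; apply: ml => //.
  exact: upd_pred.
have fl x y z : T x -> T y -> T z -> f (y + z) x = f y x + f z x.
  move=> Tx Ty Tz; rewrite /f !(updC _ _ _ ij).
  rewrite -[y in LHS]scale1r -[X in _ = X + _]mul1r; apply: ml => //.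
  exact: upd_pred.
have fD y z : T y -> T z -> f (y + z) (y + z) = f y y + f y z + (f z y + f z z).
  move=> Ty Tz; have Tyz : T (y + z) by rewrite -[y]scale1r; apply: Tl.
  by rewrite fl // !fr.
have -> : v \o tperm i j = upd (upd v i (v j)) j (v i).
  apply/funext => l; rewrite /upd /=; case: tpermP => [->|->|/eqP li /eqP lj].
  - by rewrite (negPf ij) eqxx.
  - by rewrite eqxx.
  - by rewrite (negPf li) (negPf lj).
have fv : a v = f (v i) (v j) by rewrite /f upd_id upd_id.
have Ts : T (v i + v j) by rewrite -[v i]scale1r; apply: Tl.
move: (fD _ _ (Tv i) (Tv j)); rewrite !fyy // add0r addr0 fv.
by move/eqP; rewrite eq_sym addrC addr_eq0 => /eqP.
Qed.

Lemma alternating_on_perm v (s : 'S_k) : (forall l, T (v l)) ->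
  a (v \o s) = (-1) ^+ s * a v.
Proof.
move=> Tv; have [ts -> ] := prod_tpermP s; elim: ts => [|t ts IH] /=.
  move=> _; rewrite big_nil odd_perm1 expr0 mul1r; congr a.
  by apply/funext => l /=; rewrite perm1.
move=> /andP[dt dts]; rewrite big_cons odd_permM odd_tperm dt signr_addb /=.
set p := (\prod_(_ <- _) _)%g in IH *.
have -> : v \o (tperm t.1 t.2 * p)%g = (v \o p) \o tperm t.1 t.2.
  by apply/funext => l /=; rewrite permM.
rewrite alternating_on_swap //; last by move=> l; exact: Tv.
by rewrite IH // -mulrA mulN1r.
Qed.

(** A form vanishing on the basis E vanishes on all families of members of E, by
    the action of permutations, and then everywhere, by expanding one argument
    after the other. *)
Lemma alternating_on_basis0 (E : 'I_k -> V) v : (forall i, T (E i)) ->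
  (forall y, T y -> exists m : 'I_k -> R, y = \sum_b m b *: E b) ->
  a E = 0 -> (forall i, T (v i)) -> a v = 0.
Proof.
move=> TE span aE0 Tv.
have aI (I : 'I_k -> 'I_k) : a (E \o I) = 0.
  have [/injectiveP injI|/injectivePn[i [j ij Iij]]] := boolP (injectiveb [ffun i => I i]).
    have -> : E \o I = E \o perm injI.
      by apply/funext => l /=; rewrite permE ffunE.
    by rewrite alternating_on_perm // aE0 mulr0.
  by move: Iij; rewrite !ffunE => Iij; apply: (alt.2 _ i j) => //=; rewrite ?Iij.
suff H m : forall w, (forall i, T (w i)) ->
    (forall i : 'I_k, (m <= i)%N -> exists b, w i = E b) -> a w = 0.
  by apply: (H k) => // i; rewrite leqNgt ltn_ord.
elim: m => [|m IH] w Tw Hw.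
  have [I HI] := choice (fun i => Hw i isT).
  by rewrite (_ : w = E \o I) //; apply/funext => i; exact: HI.
have [km|mk] := leqP k m.
  by apply: IH => // i mi; have := leq_trans km mi; rewrite leqNgt ltn_ord.
pose i := Ordinal mk.
have [c Ec] := span _ (Tw i).
rewrite -(upd_id w i) Ec (multilinear_on_sum _ _ Tlin alt.1) // big1 // => b _.
rewrite IH ?mulr0 //; first exact: upd_pred.
move=> j mj; rewrite /upd; case: eqP => [_|/eqP ji]; first by exists b.
by apply: Hw; rewrite ltn_neqAle mj andbT; apply: contra ji => /eqP mj'; apply/eqP/val_inj.
Qed.

End OnT.

Lemma alternating_perm k (A : ('I_k -> V) -> R) v (s : 'S_k) :
  alternating_form A -> A (v \o s) = (-1) ^+ s * A v.
Proof.
by move=> /alternating_onT altA; apply: alternating_on_perm altA _ _ _.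
Qed.

(** w with y inserted at position p. Inserting x at position 0 turns a form A of
    R^{3,4} into its radial contraction at x. *)
Definition ins k (p : 'I_k.+1) (y : V) (w : 'I_k -> V) : 'I_k.+1 -> V :=
  fun j => oapp w y (unlift p j).

Lemma ins_at k (p : 'I_k.+1) y w : ins p y w p = y.
Proof. by rewrite /ins unlift_none. Qed.

Lemma ins_lift k (p : 'I_k.+1) y w j : ins p y w (lift p j) = w j.
Proof. by rewrite /ins liftK. Qed.

Lemma eq_ins k (p : 'I_k.+1) y w v : v p = y -> (forall j, v (lift p j) = w j) ->
  ins p y w = v.
Proof.
move=> vp vl; apply/funext => j; have [j' ->|->] := unliftP p j.
  by rewrite ins_lift vl.
by rewrite ins_at vp.
Qed.

Lemma ins_id k (p : 'I_k.+1) v : ins p (v p) (v \o lift p) = v.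
Proof. exact: eq_ins. Qed.

Lemma upd_ins_at k (p : 'I_k.+1) y w z : upd (ins p y w) p z = ins p z w.
Proof.
apply/esym/eq_ins => [|j]; first by rewrite upd_same.
by rewrite /upd -[_ == p]negbK eq_sym neq_lift /= ins_lift.
Qed.

Lemma upd_ins_lift k (p : 'I_k.+1) y w i z :
  upd (ins p y w) (lift p i) z = ins p y (upd w i z).
Proof.
apply/esym/eq_ins => [|j]; first by rewrite /upd (negPf (neq_lift p i)) ins_at.
by rewrite /upd (inj_eq lift_inj) ins_lift.
Qed.

(** [lift_perm p ord0 1] is a cycle of parity p. *)
Lemma alternating_ins_move k (A : ('I_k.+1 -> V) -> R) (p : 'I_k.+1) y w :
  alternating_form A -> A (ins p y w) = (-1) ^+ p * A (ins ord0 y w).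
Proof.
move=> altA.
have -> : ins p y w = ins ord0 y w \o lift_perm p ord0 1%g.
  apply: eq_ins => [|j] /=; first by rewrite lift_perm_id ins_at.
  by rewrite lift_perm_lift perm1 ins_lift.
by rewrite alternating_perm // odd_lift_perm odd_perm1 addbF /= addbF signr_odd.
Qed.

Lemma multilinear_ins k (A : ('I_k.+1 -> V) -> R) y :
  multilinear_form A -> multilinear_form (fun w => A (ins ord0 y w)).
Proof. by move=> ml v i c p q; rewrite -!upd_ins_lift ml. Qed.

Lemma alternating_ins k (A : ('I_k.+1 -> V) -> R) y :
  alternating_form A -> alternating_form (fun w => A (ins ord0 y w)).
Proof.
move=> [ml al]; split; first exact: multilinear_ins.
move=> v i j ij vij; apply: (al _ (lift ord0 i) (lift ord0 j)).
  by rewrite (inj_eq lift_inj).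
by rewrite !ins_lift.
Qed.

(** The sign of each term brings v i back to its own position. This is the
    algebraic part of d (A(x, ...)) = k A. *)
Lemma alternating_radial_sum k (A : ('I_k.+1 -> V) -> R) v : alternating_form A ->
  \sum_(i < k.+1) (-1) ^+ i * A (ins ord0 (v i) (v \o lift i)) = k.+1%:R * A v.
Proof.
move=> altA; rewrite (eq_bigr (fun=> A v)).
  by rewrite sumr_const card_ord mulr_natl.
move=> i _; have := alternating_ins_move i (v i) (v \o lift i) altA.
by rewrite ins_id => ->.
Qed.

(* the two ways of removing an unordered pair of indices *)
(** Removing i and then l amounts to removing two indices, lift i l and i; here
    they are removed in the other order. *)
Lemma lift_unbump k (i : 'I_k.+2) (l : 'I_k.+1) : exists l' : 'I_k.+1,
  [/\ lift (lift i l) l' = i, nat_of_ord l' = unbump l i &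
      forall j, lift (lift i l) (lift l' j) = lift i (lift l j)].
Proof.
have [l' E] : exists l', i = lift (lift i l) l'.
  have [l' E|E] := unliftP (lift i l) i; first by exists l'.
  by have := neq_lift i l; rewrite -E eqxx.
have El' : nat_of_ord l' = unbump l i.
  have := congr1 val E => /= Ei.
  have ub : unbump (bump i l) i = unbump l i.
    rewrite /unbump /bump; case: (leqP i l) => il.
      by rewrite add1n ltnNge (leq_trans il (leqnSn l)).
    by rewrite add0n il.
  by rewrite -ub {2}Ei bumpK.
exists l'; split=> // j; apply: val_inj => /=.
by rewrite El' -bumpC.
Qed.

Lemma sign_bump_unbump (i l : nat) :
  (-1) ^+ (bump i l + unbump l i) = - (-1) ^+ (i + l) :> R.
Proof.
rewrite /bump /unbump; have [il|li] := leqP i l.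
  by rewrite subn0 add1n addSn exprS mulN1r addnC.
case: i li => // i _.
by rewrite subn1 add0n addSn exprS mulN1r opprK addnC.
Qed.

(** Removing two indices from v in either order leaves the same family, and
    the same S i j is inserted in it, but the signs are opposite: the terms cancel
    in pairs. With S the Hessian of a parametrization, this is why second
    derivatives do not contribute to d. *)
Lemma alternating_hessian_sum k (A : ('I_k.+1 -> V) -> R) (v : 'I_k.+2 -> V)
    (S : 'I_k.+2 -> 'I_k.+2 -> V) :
  alternating_form A -> (forall i j, S i j = S j i) ->
  \sum_(i < k.+2) (-1) ^+ i *
    (\sum_(l < k.+1) A (upd (v \o lift i) l (S i (lift i l)))) = 0.
Proof.
move=> altA symS.
pose G (p : 'I_k.+2 * 'I_k.+1) : R :=
  (-1) ^+ (p.1 + p.2) * A (ins ord0 (S p.1 (lift p.1 p.2)) (v \o lift p.1 \o lift p.2)).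
have -> : \sum_(i < k.+2) (-1) ^+ i *
    (\sum_(l < k.+1) A (upd (v \o lift i) l (S i (lift i l)))) = \sum_p G p.
  rewrite (eq_bigr (fun i => \sum_l G (i, l))) ?pair_bigA //=; last first.
  move=> i _; rewrite mulr_sumr; apply: eq_bigr => l _.
  rewrite /G /= exprD -mulrA -alternating_ins_move //; congr (_ * A _).
  apply/esym/eq_ins; first by rewrite upd_same.
  by move=> j; rewrite /upd -[_ == l]negbK eq_sym neq_lift.
have [h Hh] := choice (fun p : 'I_k.+2 * 'I_k.+1 => lift_unbump p.1 p.2).
pose f (p : 'I_k.+2 * 'I_k.+1) := (lift p.1 p.2, h p).
have fK : involutive f.
  move=> [i l]; rewrite /f /=; have [/= E1 _ _] := Hh (i, l).
  have [/= E1' _ _] := Hh (lift i l, h (i, l)).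
  congr pair; first by [].
  by move: E1'; rewrite E1 => /lift_inj.
have GN p : G (f p) = - G p.
  case: p => i l; rewrite /G /f /=; have [/= E1 E2 E3] := Hh (i, l).
  rewrite E1 symS E2.
  have -> : (v \o lift (lift i l)) \o lift (h (i, l)) = (v \o lift i) \o lift l.
    by apply/funext => j /=; rewrite E3.
  rewrite -mulNr; congr (_ * _).
  exact: sign_bump_unbump.
have : \sum_p G p = - \sum_p G p.
  rewrite {1}(reindex_inj (inv_inj fK)) -sumrN; apply: eq_bigr => p _.
  exact: GN.
by move/eqP; rewrite -addr_eq0 -mulr2n mulrn_eq0 /= => /eqP.
Qed.

Lemma alternating_formZ k (A : ('I_k -> V) -> R) c :
  alternating_form A -> alternating_form (fun v => c * A v).
Proof.
move=> [ml al]; split=> [v p d y z|v p q pq vpq].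
  by rewrite ml mulrDr mulrCA.
by rewrite (al v p q) // mulr0.
Qed.

Lemma alternating_sum k (I : finType) (c : I -> R) (A : I -> ('I_k -> V) -> R) :
  (forall i, alternating_form (A i)) ->
  alternating_form (fun v => \sum_i c i * A i v).
Proof.
move=> altA; split=> [v p d y z|v p q pq vpq].
  rewrite mulr_sumr -big_split /=; apply: eq_bigr => i _.
  by rewrite (altA i).1 mulrDr mulrCA.
by rewrite big1 // => i _; rewrite ((altA i).2 v p q pq vpq) mulr0.
Qed.

Lemma alternating_insC k (A : ('I_k.+2 -> V) -> R) x y w : alternating_form A ->
  A (ins ord0 x (ins ord0 y w)) = - A (ins ord0 y (ins ord0 x w)).
Proof.
move=> altA; rewrite -[RHS]mulN1r -[-1](expr1) -(alternating_ins_move (lift ord0 ord0)) //.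
congr A; apply/esym/eq_ins => [|j]; first by rewrite ins_lift ins_at.
have [j' ->|->] := unliftP ord0 j; last first.
  have -> : lift (lift ord0 ord0) ord0 = ord0 :> 'I_k.+2 by apply: val_inj.
  by rewrite !ins_at.
have -> : lift (lift ord0 ord0) (lift ord0 j') = lift ord0 (lift ord0 j') :> 'I_k.+2.
  exact: val_inj.
by rewrite !ins_lift.
Qed.

Lemma alternating_ins_eq k (A : ('I_k.+1 -> V) -> R) w j : alternating_form A ->
  A (ins ord0 (w j) w) = 0.
Proof.
move=> altA; apply: (altA.2 _ ord0 (lift ord0 j)); first exact: neq_lift.
by rewrite ins_at ins_lift.
Qed.

Lemma lift_succ0 n (q : 'I_n.+1) : lift (lift ord0 q) ord0 = ord0 :> 'I_n.+2.
Proof. exact: val_inj. Qed.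

Lemma lift_succS n (q : 'I_n.+1) (j : 'I_n) :
  lift (lift ord0 q) (lift ord0 j) = lift ord0 (lift q j) :> 'I_n.+2.
Proof. by apply: val_inj; rewrite /= /bump /= !add1n ltnS addnS. Qed.

End Alternating.

(** * Pullbacks and exterior derivatives *)

Section Forms.
Variable R : realType.
Local Notation V := 'rV[R]_7.
Local Notation U := 'rV[R]_6.

(** Expanding the first argument only is what lets statements on multilinear
    expressions be proved by induction on the number of arguments. *)
Lemma multilinear_coord0 k (A : ('I_k.+1 -> V) -> R) v : multilinear_form A ->
  A v = \sum_b (v ord0) 0 b * A (ins ord0 (delta_mx 0 b) (v \o lift ord0)).
Proof.
move=> ml; rewrite -[in LHS](ins_id ord0 v) [v ord0 in LHS]row_sum_delta.
rewrite -(upd_ins_at ord0 0) multilinear_sum //.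
by apply: eq_bigr => b _; rewrite upd_ins_at.
Qed.

Lemma is_derive_multilinear k (A : ('I_k -> V) -> R) (F : 'I_k -> U -> V) u w :
  multilinear_form A -> (forall i, derivable (F i) u w) ->
  is_derive u w (fun x => A (fun i => F i x))
    (\sum_l A (upd (fun i => F i u) l ('D_w (F l) u))).
Proof.
elim: k A F => [|k IH] A F ml dF.
  have -> : (fun x => A (fun i => F i x)) = cst (A (fun i => F i u)).
    by apply/funext => x; congr A; apply/funext; case.
  by rewrite big_ord0; exact: is_derive_cst.
have -> : (fun x => A (fun i => F i x)) = \sum_(b < 7)
    ((fun x => F ord0 x 0 b) *
     (fun x => A (ins ord0 (delta_mx 0 b) (fun i => F (lift ord0 i) x)))).
  by apply/funext => x; rewrite fct_sumE multilinear_coord0.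
have dF0 b : is_derive u w (fun x => F ord0 x 0 b) ('D_w (F ord0) u 0 b).
  rewrite -derive_coord //; apply: derivableP.
  by move/derivable_mxP : (dF ord0); apply.
have dB b := IH (fun v => A (ins ord0 (delta_mx 0 b) v))
  (fun i => F (lift ord0 i)) (multilinear_ins _ ml) (fun i => dF (lift ord0 i)).
apply: (is_derive_eq (is_derive_sum (fun b => is_deriveM (dF0 b) (dB b)))).
rewrite big_split /= addrC [RHS]big_ord_recl; congr (_ + _).
  rewrite [RHS]multilinear_coord0 // upd_same; apply: eq_bigr => b _.
  by rewrite -[LHS]/(_ * _) [LHS]mulrC; congr (_ * A (ins _ _ _)).
under eq_bigr => b _ do rewrite -[_ *: _]/(_ * _) mulr_sumr.
rewrite exchange_big /=; apply: eq_bigr => l _.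
by rewrite [RHS]multilinear_coord0.
Qed.

Lemma smooth_multilinear k (D : set U) (A : ('I_k -> V) -> R) (F : 'I_k -> U -> V) :
  open D -> multilinear_form A -> (forall i, smooth D (F i)) ->
  smooth D (fun x => A (fun i => F i x)).
Proof.
move=> oD; elim: k A F => [|k IH] A F ml sF.
  have -> : (fun x => A (fun i => F i x)) = fun=> A (fun i => F i 0).
    by apply/funext => x; congr A; apply/funext; case.
  by move=> n; exact: Cn_cst.
have -> : (fun x => A (fun i => F i x)) = fun x => \sum_b F ord0 x 0 b *
     A (ins ord0 (delta_mx 0 b) (fun i => F (lift ord0 i) x)).
  by apply/funext => x; rewrite multilinear_coord0.
apply: smooth_sum => // b n; apply: CnM => //.
  exact: smooth_coord.
apply: (IH (fun v => A (ins ord0 (delta_mx 0 b) v)) (fun i => F (lift ord0 i))) => //.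
exact: multilinear_ins.
Qed.

Lemma deriveC_row (D : set U) (phi : U -> V) u v w :
  open D -> smooth D phi -> D u ->
  'D_v (fun x => 'D_w phi x) u = 'D_w (fun x => 'D_v phi x) u.
Proof.
move=> oD sphi Du; apply/rowP => j.
have dd v' w' : ('D_v' (fun x => 'D_w' phi x) u) 0 j =
    'D_v' (fun x => 'D_w' (fun y => phi y 0 j) x) u.
  rewrite -derive_coord; last first.
    by apply/diff_derivable/(smooth_differentiable _ Du)/smooth_derive.
  apply: near_eq_derive; apply: (near_open oD Du) => x Dx.
  by rewrite derive_coord //; apply/diff_derivable/(smooth_differentiable sphi).
have dC := deriveC v w oD (smooth_coord j oD sphi 2%N) Du.
exact: (etrans (dd v w) (etrans dC (esym (dd w v)))).
Qed.

(** Constancy is asked along parametrizations because these are all that the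
    exterior derivative sees of the sphere. *)
Definition locally_constant (e : V -> R) : Prop :=
  forall D phi, parametrization D phi -> forall u, D u ->
    \forall x \near u, e (phi x) = e (phi u).

Section Pullbacks.
Variables (D : set U) (phi : U -> V).
Hypothesis par : parametrization D phi.

Let oD : open D. Proof. by case: par. Qed.
Let sphi : smooth D phi. Proof. by case: par. Qed.

Let dphi u w : D u -> 'd phi u w = 'D_w phi u.
Proof. by move=> Du; rewrite deriveE //; exact: smooth_differentiable Du. Qed.

Let derivphi u w w' : D u -> derivable (fun x => 'D_w phi x) u w'.
Proof.
by move=> Du; apply/diff_derivable/(smooth_differentiable _ Du)/smooth_derive.
Qed.

Lemma locally_constant_smooth e : locally_constant e -> smooth D (e \o phi).
Proof.
move=> le n; elim: n => [|n IH] /=.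
  move=> u Du; have nfh : {near nbhs u, cst (e (phi u)) =1 e \o phi}.
    by apply: filterS (le _ _ par _ Du) => x /= ->.
  exact: cvg_trans (near_eq_cvg nfh) (cvg_cst (e (phi u))).
split=> [u Du|w].
  apply: (@near_eq_differentiable _ _ (cst (e (phi u)))) => //.
  by apply: filterS (le _ _ par _ Du) => x /= ->.
apply: (@eq_Cn _ _ _ _ (fun=> 0)) => //; last exact: Cn_cst.
move=> u Du; rewrite (near_eq_derive _ (le _ _ par _ Du)).
by rewrite (derive_cst (e (phi u))).
Qed.

Lemma smooth_pullback_const k e (A : ('I_k -> V) -> R) w :
  locally_constant e -> multilinear_form A ->
  smooth D (fun u => pullback phi (fun x v => e x * A v) u w).
Proof.
move=> le ml n.
apply: (@eq_Cn _ _ _ _ (fun u => (e \o phi) u * A (fun i => 'D_(w i) phi u))) => //.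
  move=> u Du; rewrite /pullback; congr (_ * A _); apply/funext => i.
  by rewrite dphi.
apply: CnM => //; first exact: locally_constant_smooth.
apply: (smooth_multilinear (F := fun i u => 'D_(w i) phi u)) => // i.
exact: smooth_derive.
Qed.

Lemma smooth_pullback_radial k e (A : ('I_k.+1 -> V) -> R) w :
  locally_constant e -> multilinear_form A ->
  smooth D (fun u => pullback phi (fun x v => e x * A (ins ord0 x v)) u w).
Proof.
move=> le ml n.
pose F (i : 'I_k.+1) u := ins ord0 (phi u) (fun i => 'D_(w i) phi u) i.
apply: (@eq_Cn _ _ _ _ (fun u => (e \o phi) u * A (fun i => F i u))) => //.
  move=> u Du; rewrite /pullback; congr (_ * A (ins _ _ _)); apply/funext => i.
  by rewrite dphi.
apply: CnM => //; first exact: locally_constant_smooth.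
apply: (smooth_multilinear (F := F)) => // i; rewrite /F.
have [j ->|->] := unliftP ord0 i.
  rewrite (_ : (fun u => _) = fun u => 'D_(w j) phi u).
    exact: smooth_derive.
  by apply/funext => u; rewrite ins_lift.
by rewrite (_ : (fun u => _) = phi) //; apply/funext => u; rewrite ins_at.
Qed.

Let derive_twist e (f h : U -> R) u w d : locally_constant e -> D u ->
  (forall x, D x -> f x = e (phi x) * h x) -> is_derive u w h d ->
  'D_w f u = e (phi u) * d.
Proof.
move=> le Du fh [dh <-].
have fe : \forall x \near u, f x = e (phi u) * h x.
  have nD : \forall x \near u, D x by exact: near_open oD Du (fun x Dx => Dx).
  by apply: filterS2 nD (le _ _ par _ Du) => x Dx <-; exact: fh.
by rewrite (near_eq_derive _ fe) -[LHS]/('D_w (e (phi u) \*: h) u) deriveZ.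
Qed.

(** The Leibniz rule leaves only terms with a second derivative of phi. *)
Lemma flat_d_const k e (A : ('I_k.+1 -> V) -> R) u w :
  locally_constant e -> alternating_form A -> D u ->
  flat_d (pullback phi (fun x v => e x * A v)) u w = 0.
Proof.
move=> le altA Du; rewrite /flat_d.
pose v i := 'D_(w i) phi u.
pose S i j := 'D_(w i) (fun x => 'D_(w j) phi x) u.
have symS i j : S i j = S j i by exact: (deriveC_row _ _ oD).
rewrite -[RHS](mulr0 (e (phi u))) -[X in _ = _ * X](alternating_hessian_sum v altA symS).
rewrite mulr_sumr.
apply: eq_bigr => i _; rewrite mulrCA; congr (_ * _).
apply: (derive_twist le Du (h := fun x => A (fun j => 'D_(w (lift i j)) phi x))).
  move=> x Dx; rewrite /pullback; congr (_ * A _); apply/funext => j.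
  by rewrite dphi.
by apply: is_derive_multilinear altA.1 _ => j; exact: derivphi.
Qed.

(** In the Leibniz rule, differentiating the factor x = phi u gives the
    alternated sum of [alternating_radial_sum]; the other factors contribute
    second derivatives of phi, which cancel. *)
Lemma flat_d_radial k e (A : ('I_k.+2 -> V) -> R) u w :
  locally_constant e -> alternating_form A -> D u ->
  flat_d (pullback phi (fun x v => e x * A (ins ord0 x v))) u w =
  pullback phi (fun x v => (e x * k.+2%:R) * A v) u w.
Proof.
move=> le altA Du; rewrite /flat_d.
pose v i := 'D_(w i) phi u.
pose S i j := 'D_(w i) (fun x => 'D_(w j) phi x) u.
have symS i j : S i j = S j i by exact: (deriveC_row _ _ oD).
have altB := alternating_ins (phi u) altA.
rewrite /pullback -mulrA.
have -> : (fun i => 'd phi u (w i)) = v by apply/funext => i; rewrite dphi.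
rewrite -alternating_radial_sum // -[X in _ * X]addr0.
rewrite -[X in _ = _ * (_ + X)](alternating_hessian_sum v altB symS) -big_split mulr_sumr /=.
apply: eq_bigr => i _; rewrite -mulrDr [RHS]mulrCA; congr (_ * _).
pose F (j : 'I_k.+2) x := ins ord0 (phi x) (fun j => 'D_(w (lift i j)) phi x) j.
have F0 : F ord0 = phi by apply/funext => x; rewrite /F ins_at.
have Fl j : F (lift ord0 j) = fun x => 'D_(w (lift i j)) phi x.
  by apply/funext => x; rewrite /F ins_lift.
have -> : A (ins ord0 (v i) (v \o lift i)) +
    \sum_(l < k.+1) A (ins ord0 (phi u) (upd (v \o lift i) l (S i (lift i l)))) =
    \sum_l A (upd (fun j => F j u) l ('D_(w i) (F l) u)).
  rewrite [RHS]big_ord_recl F0; congr (_ + _).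
    by rewrite upd_ins_at.
  by apply: eq_bigr => l _; rewrite Fl upd_ins_lift.
apply: (derive_twist le Du (h := fun x => A (fun j => F j x))).
  move=> x Dx; congr (_ * A (ins _ _ _)); apply/funext => j.
  by rewrite dphi.
apply: is_derive_multilinear altA.1 _ => j.
have [j' ->|->] := unliftP ord0 j; first by rewrite Fl; exact: derivphi.
by rewrite F0; apply/diff_derivable/(smooth_differentiable sphi).
Qed.

End Pullbacks.

Lemma alternating_onZ (T : V -> Prop) k (a : ('I_k -> V) -> R) c :
  alternating_on T a -> alternating_on T (fun v => c * a v).
Proof.
move=> [ml al]; split=> [v i d y z Tv Ty Tz|v i j Tv ij vij].
  by rewrite ml // mulrDr mulrCA.
by rewrite (al v i j) // mulr0.
Qed.

Lemma diff_form_const k e (A : ('I_k -> V) -> R) :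
  locally_constant e -> alternating_form A -> diff_form (fun x v => e x * A v).
Proof.
move=> le altA; split=> [x Sx|D phi par w].
  exact/alternating_onZ/alternating_onW.
exact: smooth_pullback_const altA.1.
Qed.

Lemma diff_form_radial k e (A : ('I_k.+1 -> V) -> R) :
  locally_constant e -> alternating_form A ->
  diff_form (fun x v => e x * A (ins ord0 x v)).
Proof.
move=> le altA; split=> [x Sx|D phi par w].
  exact: (alternating_onZ _ (alternating_onW _ (alternating_ins x altA))).
exact: smooth_pullback_radial altA.1.
Qed.

Lemma diff_form0 k : diff_form (fun (_ : V) (_ : 'I_k -> V) => 0 : R).
Proof.
split=> [x Sx|D phi par w n]; last exact: Cn_cst.
by split=> // *; rewrite mulr0 addr0.
Qed.

Lemma is_d0 k : is_d (fun (_ : V) (_ : 'I_k -> V) => 0 : R) (fun _ _ => 0).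
Proof.
split; [exact: diff_form0|exact: diff_form0|] => D phi par u Du w.
rewrite /flat_d /pullback big1 // => i _.
by rewrite (derive_cst (0 : R)) mulr0.
Qed.

Lemma is_d_const k e (A : ('I_k.+1 -> V) -> R) :
  locally_constant e -> alternating_form A ->
  is_d (fun x v => e x * A v) (fun _ _ => 0).
Proof.
move=> le altA; split; [exact: diff_form_const|exact: diff_form0|].
by move=> D phi par u Du w; rewrite (flat_d_const par).
Qed.

Lemma is_d_radial k e (A : ('I_k.+2 -> V) -> R) :
  locally_constant e -> alternating_form A ->
  is_d (fun x v => e x * A (ins ord0 x v)) (fun x v => e x * k.+2%:R * A v).
Proof.
move=> le altA; split; first exact: diff_form_radial.
  apply: diff_form_const altA => D phi par u Du.
  by apply: filterS (le _ _ par _ Du) => x ->.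
by move=> D phi par u Du w; rewrite (flat_d_radial par).
Qed.

End Forms.

(** * The exterior product *)

Section Ext.
Variable R : realType.
Local Notation V := 'rV[R]_7.

(** For linearity, each summand depends on the argument p through exactly one of
    the two forms, according to the block in which the permutation puts p. If v i =
    v j, composing with the transposition of i and j changes the signs only. *)
Lemma alternating_on_extprod (T : V -> Prop) k l
    (a : ('I_k -> V) -> R) (c : ('I_l -> V) -> R) :
  alternating_on T a -> alternating_on T c -> alternating_on T (extprod a c).
Proof.
move=> [mla ala] [mlc alc]; split=> [v p d y z Tv Ty Tz|v i j Tv ij vij].
  rewrite /extprod [in RHS]mulrCA -mulrDr; congr (_ * _).
  rewrite mulr_sumr -big_split /=; apply: eq_bigr => s _.
  have [q ->] : exists q, p = s q by exists ((s^-1)%g p); rewrite permKV.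
  have ul x r : upd v (s q) x (s r) = upd (v \o s) q x r.
    by rewrite /upd (inj_eq perm_inj).
  have [i Eq|j Eq] := split_ordP q.
    have El x : (fun i' => upd v (s q) x (s (lshift l i'))) =
                upd (fun i' => v (s (lshift l i'))) i x.
      by apply/funext => i'; rewrite ul Eq /upd (inj_eq (@lshift_inj _ _)).
    have Er x : (fun j => upd v (s q) x (s (rshift k j))) =
                (fun j => v (s (rshift k j))).
      by apply/funext => j; rewrite ul Eq /upd eq_rlshift.
    rewrite !El !Er (mla _ i d y z (fun i' => Tv (s (lshift l i'))) Ty Tz).
    by rewrite mulrDr mulrDl !mulrA; congr (_ * _ * _ + _); rewrite mulrC.
  have El x : (fun i' => upd v (s q) x (s (lshift l i'))) =
              (fun i' => v (s (lshift l i'))).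
    by apply/funext => i'; rewrite ul Eq /upd eq_lrshift.
  have Er x : (fun j => upd v (s q) x (s (rshift k j))) =
              upd (fun j => v (s (rshift k j))) j x.
    by apply/funext => i'; rewrite ul Eq /upd (inj_eq (@rshift_inj _ _)).
  rewrite !El !Er (mlc _ j d y z (fun j' => Tv (s (rshift k j'))) Ty Tz).
  rewrite mulrDr; congr (_ + _).
  by rewrite mulrCA.
rewrite /extprod; set S := \sum_(s : _) _.
suff : S = - S by move/eqP; rewrite -addr_eq0 -mulr2n mulrn_eq0 /= => /eqP ->; rewrite mulr0.
rewrite {1}/S (reindex_inj (mulIg (tperm i j))) -sumrN; apply: eq_bigr => s _.
have vt r : v ((s * tperm i j)%g r) = v (s r).
  by rewrite permM; case: tpermP => [->|->|//].
rewrite odd_permM odd_tperm ij addbT signrN !mulNr.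
by congr (- (_ * a _ * c _)); apply/funext => r; rewrite vt.
Qed.

Lemma alternating_on_cast (T : V -> Prop) m n (e : m = n) (a : ('I_m -> V) -> R) :
  alternating_on T a -> alternating_on T (fun v : 'I_n -> V => a (fun i => v (cast_ord e i))).
Proof.
case: n / e; rewrite (_ : (fun v => _) = a) //; apply/funext => v; congr a.
by apply/funext => i; rewrite cast_ord_id.
Qed.

Lemma odd_cast_perm m n (e : m = n) (s : 'S_m) :
  odd_perm (cast_perm e s) = odd_perm s.
Proof. by case: n / e; rewrite cast_perm_id. Qed.

End Ext.

(** * Permutations extending an injection *)

Section Counting.
Local Open Scope set_scope.
Variable R : realType.

(** The last l indices are sent to the complement of the image of I. *)
Lemma extend_injection k l (I : 'I_k -> 'I_(k + l)) : injective I ->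
  exists s : 'S_(k + l), forall i, s (lshift l i) = I i.
Proof.
move=> injI.
pose A := ~: [set I i | i in 'I_k].
have cA : #|A| = l.
  have := cardsC [set I i | i in 'I_k]; rewrite card_imset // card_ord card_ord.
  by move/addnI.
pose f (r : 'I_(k + l)) := match fintype.split r with
  inl i => I i | inr j => enum_val (cast_ord (esym cA) j) end.
have fA j : enum_val (cast_ord (esym cA) j) \in A by exact: enum_valP.
have injf : injective f.
  move=> r1 r2; rewrite /f; case: split_ordP => i1 ->; case: split_ordP => i2 ->.
  - by move/injI ->.
  - by move=> E; have := fA i2; rewrite -E inE imset_f.
  - by move=> E; have := fA i1; rewrite E inE imset_f.
  - by move/enum_val_inj/cast_ord_inj ->.
exists (perm injf) => i; rewrite permE /f.
by case: split_ordP => j; [move/lshift_inj ->|move/eqP; rewrite eq_lrshift].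
Qed.

(** The extensions form a coset of the group of permutations that fix the first k
    indices. *)
Lemma card_perm_extending k l (I : {ffun 'I_k -> 'I_(k + l)}) : injective I ->
  #|[set s : 'S_(k + l) | [ffun i => s (lshift l i)] == I]| = l`!.
Proof.
move=> injI; have [s0 Hs0] := extend_injection injI.
have -> : [set s : 'S_(k + l) | [ffun i => s (lshift l i)] == I] =
    [set (t * s0)%g | t in [set t | perm_on [set rshift k j | j in 'I_l] t]].
  apply/setP => s; rewrite inE; apply/eqP/imsetP => [/ffunP E|[t]].
    exists (s * s0^-1)%g; last by rewrite mulgKV.
    rewrite inE; apply/fintype.subsetP => r; rewrite inE => rr.
    have [i Er|j ->] := split_ordP r; last exact: imset_f.
    move: rr; rewrite permM Er; have := E i; rewrite ffunE -Hs0 => ->.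
    by rewrite permK eqxx.
  rewrite inE => ton ->; apply/ffunP => i; rewrite ffunE permM (out_perm ton) //.
  by apply/imsetP => -[j _ /eqP]; rewrite eq_lrshift.
rewrite card_imset; last exact: mulIg.
rewrite cardsE card_perm card_imset ?card_ord //; exact: rshift_inj.
Qed.

(** Relates the sum over permutations of the exterior product to the sum over
    multi-indices of the scalar product of forms. *)
Lemma sum_perm_restr k l n (e : (k + l)%N = n) (f : {ffun 'I_k -> 'I_n} -> R) :
  (forall I : {ffun 'I_k -> 'I_n}, ~ injective I -> f I = 0) ->
  \sum_(s : 'S_(k + l)) f [ffun i => cast_ord e (s (lshift l i))] =
  l`!%:R * \sum_I f I.
Proof.
case: n / e f => f f0.
rewrite (partition_big (fun s : 'S_(k + l) => [ffun i => s (lshift l i)]) predT) //=.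
rewrite mulr_sumr; apply: eq_bigr => I _.
rewrite (eq_bigr (fun=> f I)); last first.
  move=> s /eqP <-; congr f; apply/ffunP => i; rewrite !ffunE.
  by rewrite cast_ord_id.
rewrite sumr_const.
have [injI|NinjI] := pselect (injective I).
  rewrite mulr_natl -(card_perm_extending injI); congr (_ *+ _).
  by apply: eq_card => s; rewrite !inE.
by rewrite f0 // mulr0 mul0rn.
Qed.

End Counting.

(** * Orthonormal frames of R^{3,4} and of the tangent spaces *)

Section Geometry.
Variable R : realType.
Local Notation V := 'rV[R]_7.
Implicit Types (x y z : V).

Definition sg (i : 'I_7) : R := (-1) ^+ (2 < i)%N.

Lemma gE x y : g x y = \sum_(i < 7) sg i * (x 0 i * y 0 i).
Proof.
rewrite /g /cscal /qdot /cayley_of /= !mul0r !add0r.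
rewrite (eq_bigr (fun i : 'I_7 =>
  (-1) ^+ (2 < i)%N * (x 0 (inord i) * y 0 (inord i)))); last first.
  by move=> i _; rewrite inord_val.
rewrite !big_ord_recr big_ord0 /= add0r expr0 !mul1r expr1 !mulN1r.
by rewrite !opprD !addrA.
Qed.

Lemma gC x y : g x y = g y x.
Proof. by rewrite !gE; apply: eq_bigr => i _; rewrite [x 0 i * _]mulrC. Qed.

Lemma g_linearl z (c : R) x y : g (c *: x + y) z = c * g x z + g y z.
Proof.
rewrite !gE mulr_sumr -big_split /=; apply: eq_bigr => i _.
by rewrite !mxE mulrDl mulrDr; congr (_ + _); rewrite -mulrA mulrCA.
Qed.

Lemma g_linearr z (c : R) x y : g z (c *: x + y) = c * g z x + g z y.
Proof. by rewrite gC g_linearl !(gC z). Qed.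

Lemma linear_pred_tangent x : linear_pred (tangent x).
Proof.
split=> [|c y z ty tz].
  by have := g_linearr x (-1) 0 0; rewrite scaler0 addr0 mulN1r addNr.
by rewrite /tangent g_linearr ty tz mulr0 addr0.
Qed.

Lemma sgM i : sg i * sg i = 1.
Proof. by rewrite /sg -expr2 sqrr_sign. Qed.

Lemma g_delta i j : g (delta_mx 0 i) (delta_mx 0 j) = sg i *+ (i == j).
Proof.
rewrite gE (bigD1 i) //= big1 => [|k ki]; rewrite !mxE !eqxx /=.
  by rewrite mul1r addr0; case: eqP; rewrite ?mulr1 ?mulr0.
by rewrite (negPf ki) mul0r mulr0.
Qed.

Definition orthonormal7 (F : 'I_7 -> V) : Prop :=
  (forall a, g (F a) (F a) = 1 \/ g (F a) (F a) = -1) /\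
  (forall a b, a != b -> g (F a) (F b) = 0).

Definition rows (F : 'I_7 -> V) : 'M[R]_7 := \matrix_(a < 7) F a.

Definition vol (v : 'I_7 -> V) : R := \det (rows v).

Lemma alternating_vol : alternating_form vol.
Proof.
split=> [v i c y z|v i j ij vij].
  rewrite -[vol (upd v i z)]mul1r; apply: (determinant_multilinear (i0 := i)).
  - by rewrite !rowK !upd_same scale1r.
  - apply/matrixP => a b; rewrite !mxE /upd.
    by rewrite -[_ == i]negbK eq_sym neq_lift.
  - apply/matrixP => a b; rewrite !mxE /upd.
    by rewrite -[_ == i]negbK eq_sym neq_lift.
by apply: (determinant_alternate ij) => b; rewrite !mxE vij.
Qed.

Section Frame.
Variable F : 'I_7 -> V.
Hypothesis onF : orthonormal7 F.
Let q a := g (F a) (F a).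
Let G : 'M[R]_7 := diag_mx (\row_i sg i).
Let D : 'M[R]_7 := diag_mx (\row_a q a).
Let M := rows F.

Let gram : M *m G *m M^T = D.
Proof.
apply/matrixP => a b; rewrite !mxE.
have -> : \sum_j (M *m G) a j * M^T j b = g (F a) (F b).
  rewrite gE; apply: eq_bigr => j _; rewrite mul_mx_diag !mxE.
  by rewrite mulrAC mulrC.
by have [->|ab] := eqVneq a b; rewrite ?mulr1n ?mulr0n // onF.2.
Qed.

Lemma q_square a : g (F a) (F a) * g (F a) (F a) = 1.
Proof. by case: (onF.1 a) => ->; rewrite ?mulr1 // mulrNN mulr1. Qed.

Let DD : D *m D = 1%:M.
Proof.
apply/matrixP => a b; rewrite mul_diag_mx !mxE.
by have [->|ab] := eqVneq a b; rewrite ?mulr1n ?mulr0n ?mulr0 // q_square.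
Qed.

Let leftinv : G *m M^T *m D *m M = 1%:M.
Proof. by apply: mulmx1C; rewrite !mulmxA gram DD. Qed.

Lemma orthonormal7_expand y : y = \sum_a (q a * g y (F a)) *: F a.
Proof.
rewrite -[LHS]mulmx1 -leftinv !mulmxA.
apply/rowP => j; rewrite summxE [LHS]mxE; apply: eq_bigr => a _.
rewrite [RHS]mxE [M a j]mxE; congr (_ * _).
rewrite mul_mx_diag mxE [(\row__ _) _ _]mxE mulrC; congr (_ * _).
rewrite mxE gE; apply: eq_bigr => i _; rewrite mul_mx_diag !mxE.
by rewrite mulrAC mulrC.
Qed.

(** The rows of F being orthonormal, so are its columns. *)
Lemma orthonormal7_complete i j :
  \sum_a q a * (F a 0 i * F a 0 j) = sg i *+ (i == j).
Proof.
have GG : G *m G = 1%:M.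
  apply/matrixP => a b; rewrite mul_diag_mx !mxE.
  by have [->|ab] := eqVneq a b; rewrite ?mulr1n ?mulr0n ?mulr0 // sgM.
have E : M^T *m D *m M = G.
  have GX : G *m (M^T *m D *m M) = 1%:M by rewrite !mulmxA.
  by rewrite -[LHS]mul1mx -GG -(mulmxA G G) GX mulmx1.
have -> : sg i *+ (i == j) = (M^T *m D *m M) i j by rewrite E !mxE.
rewrite [RHS]mxE; apply: eq_bigr => a _; rewrite mul_mx_diag !mxE.
by rewrite mulrA [q a * _]mulrC.
Qed.

(** The determinant of the Gram matrix; the metric itself has determinant 1, as
    four of its signs are negative. *)
Lemma vol_square : vol F ^+ 2 = \prod_a g (F a) (F a).
Proof.
have := congr1 determinant gram; rewrite !det_mulmx det_tr !det_diag.
have -> : \prod_i (\row_i sg i) 0 i = 1 :> R.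
  rewrite (eq_bigr (fun i : 'I_7 => (-1) ^+ (2 < i)%N)) => [|i _]; last by rewrite mxE.
  rewrite !big_ord_recr big_ord0 /=; ring.
rewrite mulr1 -expr2 => ->.
by apply: eq_bigr => a _; rewrite mxE.
Qed.

(** The inverse metric is the sum of the g(F_a, F_a) F_a (x) F_a over any
    orthonormal frame F; the left-hand side is the case of the standard basis. *)
Lemma contract_frame k l (A : ('I_k.+1 -> V) -> R) (B : ('I_l.+1 -> V) -> R) v w :
  multilinear_form A -> multilinear_form B ->
  \sum_i sg i * (A (ins ord0 (delta_mx 0 i) v) * B (ins ord0 (delta_mx 0 i) w)) =
  \sum_a q a * (A (ins ord0 (F a) v) * B (ins ord0 (F a) w)).
Proof.
move=> mlA mlB.
have EA y : A (ins ord0 y v) = \sum_b y 0 b * A (ins ord0 (delta_mx 0 b) v).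
  rewrite multilinear_coord0 // ins_at; apply: eq_bigr => b _.
  by congr (_ * A (ins _ _ _)); apply/funext => j /=; rewrite ins_lift.
have EB y : B (ins ord0 y w) = \sum_b y 0 b * B (ins ord0 (delta_mx 0 b) w).
  rewrite multilinear_coord0 // ins_at; apply: eq_bigr => b _.
  by congr (_ * B (ins _ _ _)); apply/funext => j /=; rewrite ins_lift.
pose f i := A (ins ord0 (delta_mx 0 i) v); pose h i := B (ins ord0 (delta_mx 0 i) w).
transitivity (\sum_a \sum_i \sum_j q a * (F a 0 i * F a 0 j) * (f i * h j)).
  rewrite exchange_big /=; apply: eq_bigr => i _; rewrite exchange_big /=.
  under eq_bigr do rewrite -mulr_suml orthonormal7_complete.
  rewrite (bigD1 i) //= eqxx mulr1n big1 ?addr0 // => j ji.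
  by rewrite eq_sym (negPf ji) mul0r.
apply: eq_bigr => a _; rewrite EA EB mulr_suml mulr_sumr; apply: eq_bigr => i _.
rewrite !mulr_sumr; apply: eq_bigr => j _.
by rewrite -!/(f _) -/(h _) -!mulrA; congr (_ * (_ * _)); rewrite mulrCA.
Qed.

End Frame.

Lemma orthonormal_frame_ins x E p : S33 x -> orthonormal_frame x E ->
  orthonormal7 (ins p x E).
Proof.
move=> Sx [tE nE oE]; split=> [a|a b].
  have [i ->|->] := unliftP p a; first by rewrite ins_lift.
  by rewrite ins_at; right.
have [i ->|->] := unliftP p a; have [j ->|->] := unliftP p b; rewrite ?ins_at ?ins_lift.
- by rewrite (inj_eq lift_inj) => /oE.
- by move=> _; rewrite gC; exact: tE.
- by move=> _; exact: tE.
- by rewrite eqxx.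
Qed.

Lemma frame_span x E y : S33 x -> orthonormal_frame x E -> tangent x y ->
  exists m : 'I_6 -> R, y = \sum_b m b *: E b.
Proof.
move=> Sx fE ty; have on := orthonormal_frame_ins ord0 Sx fE.
exists (fun b => g (E b) (E b) * g y (E b)).
rewrite {1}(orthonormal7_expand on y) big_ord_recl ins_at.
rewrite (gC y x) ty mulr0 scale0r add0r.
by apply: eq_bigr => b _; rewrite ins_lift.
Qed.

Lemma vol_square_frame x E : S33 x -> orthonormal_frame x E ->
  vol (ins ord0 x E) ^+ 2 = - \prod_i g (E i) (E i).
Proof.
move=> Sx fE; rewrite vol_square; last exact: orthonormal_frame_ins.
rewrite big_ord_recl ins_at Sx mulN1r; congr (- _).
by apply: eq_bigr => i _; rewrite ins_lift.
Qed.

(** This is where the signature (3, 3) of the tangent space enters; by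
    [vol_square] it only amounts to a square being nonnegative. *)
Lemma prod_frame x E : S33 x -> orthonormal_frame x E -> 
  \prod_i g (E i) (E i) = -1.
Proof.
move=> Sx fE; have := vol_square_frame Sx fE.
have [_ nE _] := fE.
have : \prod_i g (E i) (E i) = 1 \/ \prod_i g (E i) (E i) = -1.
  elim/big_ind: _ => [|p r [] -> [] ->|i _]; rewrite ?mulr1 ?mul1r ?mulrNN ?mulr1; auto.
case=> -> // H; have := sqr_ge0 (vol (ins ord0 x E)).
by rewrite H lerNr oppr0 ler10.
Qed.

Lemma vol_frame x E : S33 x -> orthonormal_frame x E -> vol (ins ord0 x E) ^+ 2 = 1.
Proof. by move=> Sx fE; rewrite vol_square_frame // (prod_frame Sx fE) opprK. Qed.

Definition reflect_vec n y : V := y - (2 * g n y / g n n) *: n.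

Lemma g_reflect n y z : g n n != 0 -> g (reflect_vec n y) (reflect_vec n z) = g y z.
Proof.
move=> n0; have E y' : reflect_vec n y' = (- (2 * g n y' / g n n)) *: n + y'.
  by rewrite scaleNr addrC.
rewrite !E g_linearl !g_linearr (gC y n); field.
exact: n0.
Qed.

(** With o the last basis vector, g(o, o) = -1 = g(x, x), so that the reflection in
    x + o or in x - o exchanges x with o up to sign, and takes the six other
    basis vectors to a frame of the tangent space at x. One of these two vectors is
    not isotropic. *)
Lemma exists_frame x : S33 x -> exists E, orthonormal_frame x E.
Proof.
move=> Sx; pose o : V := delta_mx 0 ord_max.
have goo : g o o = -1 by rewrite g_delta eqxx mulr1n /sg expr1.
have [s s1 n0] : exists2 s : R, s * s = 1 & g (s *: o + x) (s *: o + x) != 0.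
  have Eg s : s * s = 1 -> g (s *: o + x) (s *: o + x) = 2 * (s * g o x - 1).
    move=> s1; rewrite g_linearl !g_linearr goo Sx (gC x o).
    transitivity (- (s * s) + 2 * (s * g o x) - 1); first by ring.
    by rewrite s1; ring.
  have [E|N] := eqVneq (g o x) 1.
    exists (-1); rewrite ?mulrNN ?mulr1 // Eg ?mulrNN ?mulr1 // E.
    by rewrite mulN1r -opprD mulrN oppr_eq0 mulf_neq0 // lt0r_neq0.
  exists 1; first by rewrite mulr1.
  by rewrite Eg ?mulr1 // mul1r mulf_neq0 ?pnatr_eq0 // subr_eq0.
set n := s *: o + x in n0.
have gnn : g n n = 2 * g n x.
  rewrite /n g_linearl !g_linearr goo Sx (gC x o) g_linearl Sx.
  transitivity (- (s * s) + 2 * (s * g o x) - 1); first by ring.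
  by rewrite s1; ring.
have rx : reflect_vec n x = - (s *: o).
  rewrite /reflect_vec -gnn divff // scale1r /n opprD addrCA subrr addr0 //.
pose E (i : 'I_6) := reflect_vec n (delta_mx 0 (widen_ord (leqnSn 6) i)).
exists E; split=> [i|i|i j ij].
- rewrite /tangent -(g_reflect x (E i) n0) rx.
  have -> : reflect_vec n (E i) = delta_mx 0 (widen_ord (leqnSn 6) i).
    rewrite /E; set e := delta_mx _ _.
    rewrite /reflect_vec; set c := 2 * g n e / g n n.
    have -> : g n (e - c *: n) = - g n e.
      rewrite addrC -scaleNr g_linearr /c; field; exact: n0.
    rewrite mulrN mulNr -/c scaleNr opprK subrK //.
  rewrite -[- _]addr0 -scaleNr g_linearl g_delta.
  have -> : (ord_max == widen_ord (leqnSn 6) i) = false.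
    apply/negP => /eqP/(congr1 val) /= Ei; by have := ltn_ord i; rewrite -Ei ltnn.
  have := g_linearl (delta_mx 0 (widen_ord (leqnSn 6) i)) (-1) 0 0.
  by rewrite scaler0 addr0 mulN1r addNr mulr0n mulr0 add0r.
- rewrite g_reflect // g_delta eqxx mulr1n /sg; case: (_ < _)%N; [by right|by left].
rewrite g_reflect // g_delta.
have -> : (widen_ord (leqnSn 6) i == widen_ord (leqnSn 6) j) = false.
  by apply/negP => /eqP/(congr1 val) /= /val_inj/eqP; rewrite (negPf ij).
by [].
Qed.

End Geometry.

(** * The Hodge dual of a 3-form of R^{3,4} *)

Section HodgeStar.
Variable R : realType.
Local Notation V := 'rV[R]_7.
Local Notation U := 'rV[R]_6.
Implicit Types (x y z : V).

Definition ins3 k x y z (w : 'I_k -> V) : 'I_k.+3 -> V :=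
  ins ord0 x (ins ord0 y (ins ord0 z w)).

Definition nilv : 'I_0 -> V := fun _ => 0.

Section Star3.
Variable alpha : ('I_3 -> V) -> R.
Hypothesis altalpha : alternating_form alpha.

Definition star_term (w : 'I_4 -> V) x y z : R :=
  alpha (ins3 x y z nilv) * vol (ins3 x y z w).

(** The Hodge dual of alpha: its value on w is the scalar product of alpha with the
    3-form vol(., ., ., w). The factor 1/6 compensates for the repetitions of each
    set of three indices. *)
Definition star3 (w : 'I_4 -> V) : R :=
  6^-1 * \sum_i sg R i * \sum_j sg R j * \sum_k sg R k *
    star_term w (delta_mx 0 i) (delta_mx 0 j) (delta_mx 0 k).

Lemma alternating_ins3 k (A : ('I_k.+3 -> V) -> R) x y z :
  alternating_form A -> alternating_form (fun w => A (ins3 x y z w)).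
Proof.
move=> altA.
exact: (alternating_ins z (alternating_ins y (alternating_ins x altA))).
Qed.

Lemma alternating_star_term x y z : alternating_form (fun w => star_term w x y z).
Proof.
exact: alternating_formZ (alternating_ins3 x y z (alternating_vol R)).
Qed.

Lemma alternating_star3 : alternating_form star3.
Proof.
apply: alternating_formZ; do 3 apply: alternating_sum => ?.
exact: alternating_star_term.
Qed.

Lemma sum_mul_exchange (I J : finType) (a : I -> R) (b : J -> R) (u : I -> J -> R) :
  \sum_i a i * \sum_j b j * u i j = \sum_j b j * \sum_i a i * u i j.
Proof.
under eq_bigr do rewrite mulr_sumr.
rewrite exchange_big /=; apply: eq_bigr => j _; rewrite mulr_sumr.
by apply: eq_bigr => i _; rewrite mulrCA.
Qed.

(** One contraction at a time. *)
Lemma star3_frame F w : orthonormal7 F ->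
  star3 w = 6^-1 * \sum_a g (F a) (F a) * \sum_b g (F b) (F b) *
    \sum_c g (F c) (F c) * star_term w (F a) (F b) (F c).
Proof.
move=> onF; rewrite /star3; congr (_ * _).
pose q a := g (F a) (F a).
have c3 x y : \sum_k sg R k * star_term w x y (delta_mx 0 k) =
    \sum_c q c * star_term w x y (F c).
  exact: (contract_frame onF _ _ (multilinear_ins y (multilinear_ins x altalpha.1))
    (multilinear_ins y (multilinear_ins x (alternating_vol R).1))).
have c2 x z : \sum_k sg R k * star_term w x (delta_mx 0 k) z =
    \sum_c q c * star_term w x (F c) z.
  exact: (contract_frame onF _ _ (multilinear_ins x altalpha.1)
    (multilinear_ins x (alternating_vol R).1)).
have c1 y z : \sum_k sg R k * star_term w (delta_mx 0 k) y z =
    \sum_c q c * star_term w (F c) y z.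
  exact: (contract_frame onF _ _ altalpha.1 (alternating_vol R).1).
set rhs := (X in _ = X).
under eq_bigr do under eq_bigr do rewrite c3.
under eq_bigr do rewrite sum_mul_exchange.
under eq_bigr do under eq_bigr do rewrite c2.
rewrite sum_mul_exchange.
under eq_bigr do rewrite sum_mul_exchange.
under eq_bigr do under eq_bigr do rewrite c1.
under eq_bigr do rewrite sum_mul_exchange.
rewrite sum_mul_exchange.
under eq_bigr do rewrite sum_mul_exchange.
by [].
Qed.

Lemma sum_ins3 k (u : V -> R) x y z (w : 'I_k -> V) :
  \sum_i u (ins3 x y z w i) = u x + (u y + (u z + \sum_i u (w i))).
Proof.
rewrite !big_ord_recl /ins3 !(ins_at, ins_lift).
by congr (_ + (_ + (_ + _))); apply: eq_bigr => i _; rewrite !ins_lift.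
Qed.

(** In the frame (x, y, z, w) the determinant vanishes as soon as a vector of w, or
    twice the same vector, is contracted. The six orderings of x, y, z remain;
    they contribute equally, alpha and the determinant changing sign together. *)
Lemma star3_orthonormal x y z w : orthonormal7 (ins3 x y z w) ->
  star3 w = g x x * g y y * g z z * (alpha (ins3 x y z nilv) * vol (ins3 x y z w)).
Proof.
move=> onF; rewrite (star3_frame _ onF).
set t := star_term w; rewrite -/(t x y z).
have altv := alternating_vol R.
have t12 p q r : t p q r = t q p r.
  by rewrite /t /star_term /ins3 (alternating_insC _ _ _ altalpha)
    (alternating_insC _ _ _ altv) mulrNN.
have t23 p q r : t p q r = t p r q.
  by rewrite /t /star_term /ins3 (alternating_insC _ _ _ (alternating_ins p altalpha))
    (alternating_insC _ _ _ (alternating_ins p altv)) mulrNN.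
have t3w p q i : t p q (w i) = 0.
  rewrite /t /star_term /ins3 (alternating_ins_eq _ _
    (alternating_ins q (alternating_ins p altv))).
  by rewrite mulr0.
have t23_0 p q : t p q q = 0.
  have := alternating_ins_eq (ins ord0 q nilv) ord0 (alternating_ins p altalpha).
  by rewrite ins_at /t /star_term /ins3 => ->; rewrite mul0r.
have t2w p i r : t p (w i) r = 0 by rewrite t23.
have t1w i q r : t (w i) q r = 0 by rewrite t12.
have t13_0 p q : t p q p = 0 by rewrite t12.
have t12_0 p q : t p p q = 0 by rewrite t23.
have s3 p q : \sum_c g (ins3 x y z w c) (ins3 x y z w c) * t p q (ins3 x y z w c) =
    g x x * t p q x + (g y y * t p q y + g z z * t p q z).
  rewrite (sum_ins3 (fun v => g v v * t p q v)) big1 ?addr0 // => i _.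
  by rewrite t3w mulr0.
under eq_bigr do under eq_bigr do rewrite s3.
pose h p q := g x x * t p q x + (g y y * t p q y + g z z * t p q z).
have s2 p : \sum_b g (ins3 x y z w b) (ins3 x y z w b) * h p (ins3 x y z w b) =
    g x x * h p x + (g y y * h p y + g z z * h p z).
  rewrite (sum_ins3 (fun v => g v v * h p v)) big1 ?addr0 // => i _.
  by rewrite /h !t2w !mulr0 !addr0 mulr0.
under eq_bigr do rewrite s2.
pose h' p := g x x * h p x + (g y y * h p y + g z z * h p z).
rewrite (sum_ins3 (fun v => g v v * h' v)) big1 => [|i _]; last first.
  by rewrite /h' /h !t1w !mulr0 !addr0 !mulr0 !addr0 mulr0.
rewrite /h' /h !(t23_0, t12_0, t13_0).
rewrite (t23 x z y) (t12 y x z) (t12 z x y) (t23 x z y) (t23 y z x) (t12 y x z).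
rewrite (t12 z y x) (t23 y z x) (t12 y x z).
rewrite -[alpha _ * _]/(t x y z); by field.
Qed.

End Star3.
End HodgeStar.

(** * Metric volume forms *)

Section VolumeSign.
Variable R : realType.
Local Notation V := 'rV[R]_7.
Local Notation U := 'rV[R]_6.

(** The derivative of g(phi, phi) = -1. *)
Lemma parametrization_tangent (D : set U) (phi : U -> V) u w :
  parametrization D phi -> D u -> tangent (phi u) ('d phi u w).
Proof.
move=> par Du; have [oD sphi SD _ _] := par.
pose A (v : 'I_2 -> V) := g (v ord0) (v ord_max).
have mlA : multilinear_form A.
  move=> v i c y z; rewrite /A /upd.
  have [->|ni] := eqVneq i ord0; first by rewrite g_linearl.
  have -> : i = ord_max.
    by apply: val_inj; case: i ni => -[|[|]] //.
  by rewrite g_linearr.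
have dphi : derivable phi u w by exact/diff_derivable/(smooth_differentiable sphi).
have [_ E] := is_derive_multilinear (F := fun _ => phi) mlA (fun _ => dphi).
have E0 : 'D_w (fun x => A (fun _ => phi x)) u = 0.
  rewrite -(derive_cst (-1 : R) u w); apply: near_eq_derive.
  exact: (near_open oD Du SD).
move: E; rewrite E0 big_ord_recl big_ord_recl big_ord0 addr0 /A /upd /=.
rewrite deriveE; last exact: smooth_differentiable Du.
rewrite (gC ('d phi u w)) -mulr2n => /esym/eqP.
by rewrite mulrn_eq0 /= => /eqP.
Qed.

(** A linear relation between x = phi u and the partial derivatives has zero
    coefficient on x, since g(x, x) = -1 and the derivatives are orthogonal to x;
    the rest is a vector in the kernel of 'd phi u. *)
Lemma vol_parametrization_neq0 (D : set U) (phi : U -> V) u :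
  parametrization D phi -> D u ->
  vol (ins ord0 (phi u) (fun i => 'd phi u (delta_mx 0 i))) != 0.
Proof.
move=> par Du; have [oD sphi SD _ inj] := par.
apply/det0P => -[v vn0 vM].
pose w : U := \row_i v 0 (lift ord0 i).
have E : v 0 ord0 *: phi u + 'd phi u w = 0.
  rewrite -[RHS]vM mulmx_sum_row big_ord_recl /rows rowK ins_at.
  rewrite (row_sum_delta w) linear_sum; congr (_ + _); apply: eq_bigr => i _.
  by rewrite linearZ rowK ins_lift mxE.
have tg0 := (linear_pred_tangent (phi u)).1.
have v0 : v 0 ord0 = 0.
  have := g_linearr (phi u) (v 0 ord0) (phi u) ('d phi u w).
  rewrite E tg0 (SD u Du) (parametrization_tangent w par Du) addr0 mulrN1.
  by move/eqP; rewrite eq_sym oppr_eq0 => /eqP.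
have w0 : w = 0.
  by apply: (inj u Du); move: E; rewrite v0 scale0r add0r linear0.
case/eqP: vn0; apply/rowP => j; rewrite mxE.
have [i ->|->] := unliftP ord0 j; last exact: v0.
by have := congr1 (fun z : U => z 0 i) w0; rewrite !mxE.
Qed.

Lemma locally_constant_cst (c : R) : locally_constant (fun _ => c).
Proof. by move=> D phi [oD _ _ _ _] u Du; exact: near_open oD Du (fun _ _ => erefl). Qed.

Lemma locally_constantZ (c : R) e : locally_constant e ->
  locally_constant (fun x => c * e x).
Proof.
by move=> le D phi par u Du; apply: filterS (le _ _ par _ Du) => x ->.
Qed.

Lemma alternating_onBZ (T : V -> Prop) k (a b : ('I_k -> V) -> R) c :
  alternating_on T a -> alternating_on T b ->
  alternating_on T (fun v => a v - c * b v).
Proof.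
move=> [mla ala] [mlb alb]; split=> [v i d y z Tv Ty Tz|v i j Tv ij vij].
  by rewrite mla // mlb //; ring.
by rewrite (ala v i j) // (alb v i j) // mulr0 subr0.
Qed.

(** At each x, mu is a multiple e(x) of vol(x, ...), and the values on a frame
    show that e(x)^2 = 1. Along a parametrization both pullbacks are continuous
    and do not vanish, so the sign cannot jump. *)
Lemma metric_volume_form_sign (mu : kform R 6) : metric_volume_form mu ->
  exists e : V -> R, [/\ locally_constant e, (forall x, S33 x -> e x * e x = 1) &
    forall x v, S33 x -> (forall i, tangent x (v i)) ->
      mu x v = e x * vol (ins ord0 x v)].
Proof.
move=> [[altmu smu] nmu].
have [fr frP] : {fr : V -> 'I_6 -> V & forall x, S33 x -> orthonormal_frame x (fr x)}.
  apply: (@choice _ _ (fun x E => S33 x -> orthonormal_frame x E)) => x.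
  have [Sx|NSx] := pselect (S33 x); first by have [E fE] := exists_frame Sx; exists E.
  by exists (fun _ => 0).
pose e x := mu x (fr x) * vol (ins ord0 x (fr x)).
have e1 x : S33 x -> e x * e x = 1.
  move=> Sx; rewrite /e mulrACA -!expr2 vol_frame ?mulr1 //; last exact: frP.
  by rewrite -[X in X ^+ 2 = _]/(mu x (fr x)) -real_normK ?num_real // nmu ?expr1n //; exact: frP.
have muE x v : S33 x -> (forall i, tangent x (v i)) ->
    mu x v = e x * vol (ins ord0 x v).
  move=> Sx Tv; have fE := frP x Sx; have [TE _ _] := fE.
  apply/eqP; rewrite -subr_eq0; apply/eqP.
  have altd := alternating_onBZ (e x) (altmu x Sx)
    (alternating_onW (tangent x) (alternating_ins x (alternating_vol R))).
  apply: (alternating_on_basis0 (linear_pred_tangent x) altd TE) => //.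
    by move=> y; exact: frame_span.
  by rewrite /e -mulrA -expr2 vol_frame // mulr1 subrr.
exists e; split=> // D phi par u Du; have [oD sphi SD _ _] := par.
pose dl (i : 'I_6) : U := delta_mx 0 i.
pose h x := pullback phi mu x dl.
pose k x := pullback phi (fun x v => 1 * vol (ins ord0 x v)) x dl.
have hk x : D x -> h x = e (phi x) * k x.
  move=> Dx; rewrite /h /k /pullback mul1r; apply: muE; first exact: SD.
  by move=> i; exact: (parametrization_tangent (dl i) par Dx).
have kn0 : k u != 0 by rewrite /k /pullback mul1r; exact: vol_parametrization_neq0 Du.
have sk : smooth D k.
  exact: smooth_pullback_radial (locally_constant_cst 1) (alternating_vol R).1.
have ch : {for u, continuous (fun x => h u * k u * (h x * k x))}.
  have Ch : Cn 0 D (fun x => h u * k u * (h x * k x)).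
    exact: (CnM oD (Cn_cst 0 D (h u * k u)) (CnM oD (smu _ _ par dl 0%N) (sk 0%N))).
  exact: Ch.
(* h k = e k^2 has the sign of e. *)
have pos : 0 < h u * k u * (h u * k u).
  rewrite -expr2 exprn_even_gt0 //= mulf_neq0 // hk // mulf_neq0 //.
  by apply/eqP => e0; have := e1 _ (SD u Du); rewrite e0 mul0r => /esym/eqP; rewrite oner_eq0.
have nD : \forall x \near u, D x by exact: near_open oD Du (fun x Dx => Dx).
have /cvgr_gt/(_ _ pos) npos := ch.
apply: filterS2 nD npos => x Dx.
rewrite hk // (hk x Dx).
have eu := e1 _ (SD u Du); have ex := e1 _ (SD x Dx).
have Q (a b p q : R) : a * p * p * (b * q * q) = a * b * (p * q) ^+ 2 by ring.
rewrite Q.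
have sq : e (phi x) = e (phi u) \/ e (phi x) = - e (phi u).
  have /eqP := etrans ex (esym eu); rewrite -!expr2 eqf_sqr => /orP[]/eqP ->; [by left|by right].
by case: sq => // ->; rewrite mulrN eu mulN1r oppr_gt0 ltNge sqr_ge0.
Qed.

End VolumeSign.

(** * The Hodge operator on orthonormal frames *)

Section HodgeCriterion.
Variable R : realType.
Local Notation V := 'rV[R]_7.

Lemma orthonormal_frame_perm (x : V) E (s : 'S_6) :
  orthonormal_frame x E -> orthonormal_frame x (E \o s).
Proof.
move=> [tE nE oE]; split=> [i|i|i j ij] /=; [exact: tE|exact: nE|].
by apply: oE; rewrite (inj_eq perm_inj).
Qed.

(** It is enough to test the defining identity on an orthonormal frame E, both
    sides being alternating in v. There the exterior product is a sum over
    permutations s; the hypothesis applied to the permuted frame turns its s-term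
    into the term of multi-index s(0), ..., s(k-1) of the scalar product, each of
    which is obtained l! times. *)
Lemma is_hodge_frames (mu : kform R 6) k l (kl : (k + l)%N = 6)
    (b : kform R k) (c : kform R l) :
  metric_volume_form mu -> diff_form b -> diff_form c ->
  (forall x E, S33 x -> orthonormal_frame x E ->
    c x (fun j => E (cast_ord kl (rshift k j))) =
    (\prod_(i < k) g (E (cast_ord kl (lshift l i))) (E (cast_ord kl (lshift l i)))) *
      b x (fun i => E (cast_ord kl (lshift l i))) * mu x E) ->
  is_hodge mu kl b c.
Proof.
move=> [[altmu _] _] db dc crit; split=> // x Sx E fE a alta v Tv.
have [TE _ _] := fE.
apply/eqP; rewrite -subr_eq0; apply/eqP.
have altd := alternating_onBZ (form_scal E a (b x))
  (alternating_on_cast kl (alternating_on_extprod alta (dc.1 x Sx))) (altmu x Sx).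
apply: (alternating_on_basis0 (linear_pred_tangent x) altd TE _ _ Tv).
  by move=> y; exact: frame_span.
apply/eqP; rewrite subr_eq0; apply/eqP.
pose f (I : {ffun 'I_k -> 'I_6}) := (\prod_(i < k) g (E (I i)) (E (I i))) *
   a (fun i => E (I i)) * b x (fun i => E (I i)).
have f0 (I : {ffun 'I_k -> 'I_6}) : ~ injective I -> f I = 0.
  move=> NI; have [i [j [ij Iij]]] : exists i j, i != j /\ I i = I j.
    have [/injectiveP //|/injectivePn[i [j ij Iij]]] := boolP (injectiveb I).
    by exists i, j.
  by rewrite /f (alta.2 _ i j) ?mulr0 ?mul0r // Iij.
rewrite /extprod (eq_bigr (fun s : 'S_(k + l) =>
    f [ffun i => cast_ord kl (s (lshift l i))] * mu x E)); last first.
  move=> s _; set t := cast_perm kl s.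
  have tE r : E (cast_ord kl (s r)) = (E \o t) (cast_ord kl r).
    by rewrite /= /t cast_ord_permE.
  have -> : (fun j => E (cast_ord kl (s (rshift k j)))) =
     (fun j => (E \o t) (cast_ord kl (rshift k j))) by apply/funext => j; exact: tE.
  rewrite (crit x _ Sx (orthonormal_frame_perm t fE)).
  rewrite (alternating_on_perm (linear_pred_tangent x) (altmu x Sx) t TE) odd_cast_perm.
  have If : (fun i => (E \o t) (cast_ord kl (lshift l i))) =
     (fun i => E ([ffun i => cast_ord kl (s (lshift l i))] i)).
    by apply/funext => i; rewrite ffunE tE.
  rewrite /f If.
  have -> : (fun i => E (cast_ord kl (s (lshift l i)))) =
     (fun i => E ([ffun i => cast_ord kl (s (lshift l i))] i)).
    by apply/funext => i; rewrite ffunE.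
  have -> : \prod_(i < k) g ((E \o t) (cast_ord kl (lshift l i)))
                        ((E \o t) (cast_ord kl (lshift l i))) =
    \prod_(i < k) g (E ([ffun i => cast_ord kl (s (lshift l i))] i))
                  (E ([ffun i => cast_ord kl (s (lshift l i))] i)).
    by apply: eq_bigr => i _; rewrite !ffunE tE.
  set p := \prod_(i < k) _; set a' := a _; set b' := b _ _; set m := mu x E.
  have sg1 : (-1) ^+ s * (-1) ^+ s = 1 :> R by rewrite -expr2 sqrr_sign.
  have Q (q a1 p1 b1 m1 : R) : q * a1 * (p1 * b1 * (q * m1)) = q * q * (p1 * a1 * b1 * m1).
    by ring.
  by rewrite Q sg1 mul1r.
rewrite -mulr_suml sum_perm_restr // /form_scal -/f mulrA mulrA.
by congr (_ * _ * _); rewrite invfM -mulrA mulVf ?mulr1 // pnatr_eq0 -lt0n fact_gt0.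
Qed.

End HodgeCriterion.

(** * The Laplacian of the radial contraction of a 3-form *)

Section Radial.
Variable R : realType.
Local Notation V := 'rV[R]_7.
Variables (alpha : ('I_3 -> V) -> R) (mu : kform R 6).
Hypotheses (altalpha : alternating_form alpha) (mu_vol : metric_volume_form mu).
Let psi := star3 alpha.
Let altpsi : alternating_form psi := alternating_star3 alpha.

Lemma ins3_frame k (E : 'I_k.+2 -> V) x :
  ins ord0 x E = ins3 x (E ord0) (E (lift ord0 ord0)) (fun j => E (lift ord0 (lift ord0 j))).
Proof.
rewrite /ins3; congr (ins _ _ _); apply/esym/eq_ins => // j.
have /(congr1 (fun f : 'I_k.+1 -> V => f j)) := ins_id ord0 (fun j => E (lift ord0 j)); exact: esym.
Qed.

Lemma ins3_nil (v : 'I_3 -> V) :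
  ins3 (v ord0) (v (lift ord0 ord0)) (v (lift ord0 (lift ord0 ord0))) (@nilv R) = v.
Proof.
rewrite -[RHS](ins_id ord0) -[v \o lift ord0 in RHS](ins_id ord0).
rewrite -[(v \o lift ord0) \o lift ord0 in RHS](ins_id ord0) /ins3 /=.
by congr (ins _ _ (ins _ _ (ins _ _ _))); apply/funext; case.
Qed.

Lemma ins2_nil x (v : 'I_2 -> V) :
  ins ord0 x v = ins3 x (v ord0) (v (lift ord0 ord0)) (@nilv R).
Proof.
rewrite -[in LHS](ins_id ord0 v) -[v \o lift ord0 in LHS](ins_id ord0) /ins3 /=.
by congr (ins _ _ (ins _ _ (ins _ _ _))); apply/funext; case.
Qed.

(** The frame is (x, E_0, ..., E_5): this yields star omega. *)
Lemma star3_radial x E : S33 x -> orthonormal_frame x E ->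
  psi (fun j => E (lift ord0 (lift ord0 j))) =
  - (g (E ord0) (E ord0) * g (E (lift ord0 ord0)) (E (lift ord0 ord0))) *
  (alpha (ins3 x (E ord0) (E (lift ord0 ord0)) (@nilv R)) * vol (ins ord0 x E)).
Proof.
move=> Sx fE; have on := orthonormal_frame_ins ord0 Sx fE.
rewrite ins3_frame in on; rewrite /psi (star3_orthonormal altalpha on) Sx mulN1r.
by rewrite -ins3_frame !mulNr.
Qed.

(** The frame is (E_0, E_1, E_2, x, E_3, E_4, E_5), whose determinant is opposite to
    that of (x, E): this yields star alpha. *)
Lemma star3_tangential x E : S33 x -> orthonormal_frame x E ->
  psi (ins ord0 x (fun j => E (lift ord0 (lift ord0 (lift ord0 j))))) =
  - (g (E ord0) (E ord0) * g (E (lift ord0 ord0)) (E (lift ord0 ord0)) *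
     g (E (lift ord0 (lift ord0 ord0))) (E (lift ord0 (lift ord0 ord0)))) *
  (alpha (ins3 (E ord0) (E (lift ord0 ord0)) (E (lift ord0 (lift ord0 ord0))) (@nilv R)) *
   vol (ins ord0 x E)).
Proof.
move=> Sx fE; pose p : 'I_7 := lift ord0 (lift ord0 (lift ord0 ord0)).
have Ep : ins p x E = ins3 (E ord0) (E (lift ord0 ord0)) (E (lift ord0 (lift ord0 ord0)))
    (ins ord0 x (fun j => E (lift ord0 (lift ord0 (lift ord0 j))))).
  apply: eq_ins => [|j]; first by rewrite /ins3 !ins_lift ins_at.
  rewrite /ins3; have [j1 ->|->] := unliftP ord0 j; last by rewrite lift_succ0 !ins_at.
  rewrite lift_succS !ins_lift; have [j2 ->|->] := unliftP ord0 j1;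
    last by rewrite lift_succ0 !ins_at.
  rewrite lift_succS !ins_lift; have [j3 ->|->] := unliftP ord0 j2;
    last by rewrite lift_succ0 !ins_at.
  by rewrite lift_succS !ins_lift.
have on := orthonormal_frame_ins p Sx fE; rewrite Ep in on.
rewrite /psi (star3_orthonormal altalpha on) -Ep alternating_ins_move; last exact: alternating_vol.
have -> : (-1) ^+ p = -1 :> R by rewrite /p /= /bump /= -signr_odd.
by rewrite mulN1r !mulrN mulNr.
Qed.

(** Moves the last two vectors of a frame in front of the four others. Being a
    fourth power, it is even. *)
Definition rot4 : 'S_6 := (perm (@ordS_inj 6) ^+ 4)%g.

Lemma rot4E (i : 'I_6) : val (rot4 i) = ((i + 4) %% 6)%N.
Proof.
rewrite /rot4 !expgS expg0 !permM perm1 !permE /=.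
by case: i; do 6 case=> //.
Qed.

Lemma odd_rot4 : odd_perm rot4 = false.
Proof. by rewrite /rot4 !expgS expg0 !odd_permM odd_perm1; case: (odd_perm _). Qed.

Lemma radial3_laplacian :
  is_laplacian mu (fun x v => alpha (ins ord0 x v))
    (fun x v => - 12%:R * alpha (ins ord0 x v)).
Proof.
have [e [le e1 muE]] := metric_volume_form_sign mu_vol.
have lc c : locally_constant (fun _ : V => c : R) := locally_constant_cst c.
have TE x E : orthonormal_frame x E -> forall i, tangent x (E i) by case.
have shift3 (E : 'I_6 -> V) : (fun j => E (cast_ord (erefl 6%N) (rshift 3 j))) =
    (fun j => E (lift ord0 (lift ord0 (lift ord0 j)))).
  by apply/funext => j; congr E; exact: val_inj.
have shift2 (E : 'I_6 -> V) : (fun j => E (cast_ord (erefl 6%N) (rshift 2 j))) =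
    (fun j => E (lift ord0 (lift ord0 j))).
  by apply/funext => j; congr E; exact: val_inj.
have w0 k l (kl : (k.+1 + l)%N = 6%N) : cast_ord kl (lshift l (ord0 : 'I_k.+1)) = ord0.
  exact: val_inj.
have w1 k l (kl : (k.+2 + l)%N = 6%N) :
    cast_ord kl (lshift l (lift ord0 ord0 : 'I_k.+2)) = lift ord0 ord0.
  exact: val_inj.
have w2 k l (kl : (k.+3 + l)%N = 6%N) :
    cast_ord kl (lshift l (lift ord0 (lift ord0 ord0) : 'I_k.+3)) =
    lift ord0 (lift ord0 ord0).
  exact: val_inj.
have w3 k l (kl : (k.+4 + l)%N = 6%N) :
    cast_ord kl (lshift l (lift ord0 (lift ord0 (lift ord0 ord0)) : 'I_k.+4)) =
    lift ord0 (lift ord0 (lift ord0 ord0)).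
  exact: val_inj.
have radial1 : (fun (x : V) v => alpha (ins ord0 x v)) =
  (fun x v => (fun _ => 1) x * alpha (ins ord0 x v)).
  by apply/funext => x; apply/funext => v; rewrite mul1r.
exists (fun _ _ => 0), (fun _ _ => 0), (fun _ v => 3%:R * alpha v),
  (fun x v => - 12%:R * alpha (ins ord0 x v)); split; last first.
- by move=> x Sx v Tv; rewrite add0r.
- exists 3%N, (erefl 6%N), (erefl 6%N), (fun x v => - (3%:R) * e x * psi (ins ord0 x v)),
    (fun x v => - (3%:R) * e x * 4%:R * psi v), (fun x v => - 12%:R * alpha (ins ord0 x v)).
  split.
  + apply: is_hodge_frames mu_vol _ _ _.
    * exact: (diff_form_const (lc 3%:R) altalpha).
    * exact: (diff_form_radial (locally_constantZ _ le) altpsi).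
    move=> x E Sx fE; rewrite muE //; last exact: TE.
    rewrite shift3 (star3_tangential Sx fE) -(ins3_nil (fun i => E (cast_ord _ (lshift 3 i)))).
    rewrite !big_ord_recl big_ord0 !w0 !w1 !w2.
    have Q (p q r h w a : R) : - 3%:R * a * (- (p * q * r) * (h * w)) =
      p * (q * (r * 1)) * (3%:R * h) * (a * w) by ring.
    exact: Q.
  + exact: (is_d_radial (locally_constantZ _ le) altpsi).
  + apply: is_hodge_frames mu_vol _ _ _.
    * apply: (diff_form_const _ altpsi) => D f par u Du.
      by apply: filterS (le _ _ par _ Du) => x ->.
    * exact: (diff_form_radial (lc (- 12%:R)) altalpha).
    move=> x E Sx fE; rewrite muE //; last exact: TE.
    (* The dual of psi is read off from that of omega, in the frame
       (E_4, E_5, E_0, E_1, E_2, E_3). *)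
    have fE' := orthonormal_frame_perm rot4 fE.
    have L j : rot4 (lift ord0 (lift ord0 j)) = cast_ord (erefl 6%N) (lshift 2 j).
      apply: val_inj; rewrite rot4E /=.
      rewrite -[bump 0 _]/(j.+2) !addSnnS modnDr modn_small //.
      exact: leq_trans (ltn_ord j) _.
    have := star3_radial Sx fE'.
    have -> : (fun j => (E \o rot4) (lift ord0 (lift ord0 j))) =
        (fun j => E (cast_ord (erefl 6%N) (lshift 2 j))).
      by apply/funext => j /=; rewrite L.
    move=> ->.
    have -> : vol (ins ord0 x (E \o rot4)) = vol (ins ord0 x E).
      have /= -> := alternating_perm E rot4 (alternating_ins x (alternating_vol R)).
      by rewrite odd_rot4 expr0 mul1r.
    have r0 : rot4 ord0 = cast_ord (erefl 6%N) (rshift 4 ord0).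
      by apply: val_inj; rewrite rot4E.
    have r1 : rot4 (lift ord0 ord0) = cast_ord (erefl 6%N) (rshift 4 (lift ord0 ord0)).
      by apply: val_inj; rewrite rot4E.
    have := prod_frame Sx fE.
    have -> : \prod_i g (E i) (E i) =
      (\prod_(i < 4) g (E (cast_ord (erefl 6%N) (lshift 2 i)))
                   (E (cast_ord (erefl 6%N) (lshift 2 i)))) *
      (g (E (rot4 ord0)) (E (rot4 ord0)) *
       g (E (rot4 (lift ord0 ord0))) (E (rot4 (lift ord0 ord0)))).
      rewrite (@big_split_ord _ _ _ 4 2) /=; congr (_ * _).
        apply: eq_bigr => i _; congr (g (E _) (E _)); exact: val_inj.
      rewrite !big_ord_recl big_ord0 mulr1 r0 r1.
      by congr (g (E _) (E _) * g (E _) (E _)); exact: val_inj.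
    rewrite /= ins2_nil -r0 -r1.
    have := vol_frame Sx fE; have := e1 x Sx.
    have Q (p q4 q5 h w a : R) : a * a = 1 -> w ^+ 2 = 1 -> p * (q4 * q5) = -1 ->
        - 12%:R * h = p * (- 3%:R * a * 4%:R * (- (q4 * q5) * (h * w))) * (a * w).
      move=> aa ww pq; transitivity (12%:R * (p * (q4 * q5)) * (a * a) * w ^+ 2 * h).
        by rewrite aa ww pq !mulr1 mulrN1.
      ring.
    exact: Q.
  + move=> x Sx v Tv; rewrite -signr_odd /= expr0 mul1r //.
- rewrite radial1; have := is_d_radial (lc 1) altalpha.
  by rewrite mul1r.
- exact: is_d0.
exists 4%N, (erefl 6%N), (erefl 6%N), (fun x v => - 1 * e x * psi v),
    (fun _ _ => 0), (fun _ _ => 0); split.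
- apply: is_hodge_frames mu_vol _ _ _.
  + rewrite radial1; exact: (diff_form_radial (lc 1) altalpha).
  + exact: (diff_form_const (locally_constantZ _ le) altpsi).
  move=> x E Sx fE; rewrite muE //; last exact: TE.
  rewrite shift2 (star3_radial Sx fE) ins2_nil.
  rewrite !big_ord_recl big_ord0 !w0 !w1.
  have Q (p q h w a : R) : - 1 * a * (- (p * q) * (h * w)) =
    p * (q * 1) * h * (a * w) by ring.
  exact: Q.
- exact: (is_d_const (locally_constantZ _ le) altpsi).
- apply: is_hodge_frames mu_vol _ _ _; [exact: diff_form0|exact: diff_form0|].
  by move=> x E Sx fE; rewrite mulr0 mul0r.
by move=> x Sx v Tv; rewrite mulr0.
Qed.
End Radial.

(** * The 3-form of the vector cross product *)

Section Cross.
Variable R : realType.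
Local Notation V := 'rV[R]_7.

Definition cross_form (w : 'I_3 -> V) : R :=
  g (cross (w ord0) (w (lift ord0 ord0))) (w ord_max).

Lemma omega_radial : @omega R = fun x v => cross_form (ins ord0 x v).
Proof.
apply/funext => x; apply/funext => v.
rewrite /cross_form ins_at ins_lift /omega /paraP.
by have -> : ord_max = lift ord0 ord_max :> 'I_3; [exact: val_inj|rewrite ins_lift].
Qed.

Lemma g_crossE (x y z : V) :
  g (cross x y) z = cscal (cmul (cayley_of x) (cayley_of y)) (cayley_of z).
Proof.
rewrite /g /cross; set c := cmul _ _.
by rewrite /cscal /qdot /cayley_of /cayley_im /= !mxE !inordK //= !mul0r !mulr0.
Qed.

Definition cayley_comb (c : R) (x y : cayley R) : cayley R :=
  let q a b := Quat (c * q0 a + q0 b) (c * q1 a + q1 b) (c * q2 a + q2 b) (c * q3 a + q3 b) in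
  Cayley (q (cl x) (cl y)) (q (cr x) (cr y)).

Lemma cayley_of_comb c (x y : V) :
  cayley_of (c *: x + y) = cayley_comb c (cayley_of x) (cayley_of y).
Proof. by rewrite /cayley_of /cayley_comb /= !mxE mulr0 addr0. Qed.

Lemma cscal_cmul_linear1 c (x x' y z : cayley R) :
  cscal (cmul (cayley_comb c x x') y) z = c * cscal (cmul x y) z + cscal (cmul x' y) z.
Proof.
case: x => -[? ? ? ?] [? ? ? ?]; case: x' => -[? ? ? ?] [? ? ? ?].
case: y => -[? ? ? ?] [? ? ? ?]; case: z => -[? ? ? ?] [? ? ? ?].
by rewrite /cscal /cmul /cayley_comb /qdot /qadd /qmul /qconj /=; ring.
Qed.

Lemma cscal_cmul_linear2 c (x y y' z : cayley R) :
  cscal (cmul x (cayley_comb c y y')) z = c * cscal (cmul x y) z + cscal (cmul x y') z.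
Proof.
case: x => -[? ? ? ?] [? ? ? ?]; case: y' => -[? ? ? ?] [? ? ? ?].
case: y => -[? ? ? ?] [? ? ? ?]; case: z => -[? ? ? ?] [? ? ? ?].
by rewrite /cscal /cmul /cayley_comb /qdot /qadd /qmul /qconj /=; ring.
Qed.

Lemma g_cross_alt (x y : V) :
  [/\ g (cross x x) y = 0, g (cross x y) x = 0 & g (cross x y) y = 0].
Proof.
rewrite !g_crossE /cayley_of /=.
move: (x 0 (inord 0)) (x 0 (inord 1)) (x 0 (inord 2)) (x 0 (inord 3)) => x0 x1 x2 x3.
move: (x 0 (inord 4)) (x 0 (inord 5)) (x 0 (inord 6)) => x4 x5 x6.
move: (y 0 (inord 0)) (y 0 (inord 1)) (y 0 (inord 2)) (y 0 (inord 3)) => y0 y1 y2 y3.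
move: (y 0 (inord 4)) (y 0 (inord 5)) (y 0 (inord 6)) => y4 y5 y6.
by rewrite /cscal /cmul /qdot /qadd /qmul /qconj /=; split; ring.
Qed.

Lemma alternating_cross_form : alternating_form cross_form.
Proof.
split=> [v i c y z|v i j].
  rewrite /cross_form /upd; case: i => -[|[|[|//]]] hi.
  - by rewrite /= !g_crossE cayley_of_comb cscal_cmul_linear1.
  - by rewrite /= !g_crossE cayley_of_comb cscal_cmul_linear2.
  - by rewrite /= g_linearr.
have i012 (k : 'I_3) : [\/ k = ord0, k = lift ord0 ord0 | k = ord_max].
  by case: k => -[|[|[|//]]] hk; [constructor 1|constructor 2|constructor 3]; exact: val_inj.
have A1 (x y : V) : g (cross x x) y = 0 by have [] := g_cross_alt x y.
have A2 (x y : V) : g (cross x y) x = 0 by have [] := g_cross_alt x y.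
have A3 (x y : V) : g (cross x y) y = 0 by have [] := g_cross_alt x y.
rewrite /cross_form.
by case: (i012 i) => ->; case: (i012 j) => -> // _ E;
  rewrite E ?A1 ?A2 ?A3.
Qed.
End Cross.

Theorem theorem5p4 (R : realType) (mu : kform R 6) (mu_vol : metric_volume_form mu) :
  is_laplacian mu (@omega R) (fun x v => - 12%:R * omega x v).
Proof.
rewrite omega_radial.
exact: radial3_laplacian (@alternating_cross_form R) mu_vol.
Qed.
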